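(* Let $A,B,C,A_1,A_2$ be arbitrary nonnegative selfadjoint linear relations in a complex Hilbert space $\mathcal H$. The parallel sum has the following properties: (1) $\lambda A:\lambda B=\lambda(A:B)$ for $\lambda>0$; (2) $A:B=B:A$; (3) $(A:B):C=A:(B:C)=\big(A^{-1}\dot+B^{-1}\dot+C^{-1}\big)^{-1}$; (4) $A:B\le A$ and $A:B\le B$; (5) $A_1\le A_2$ implies $A_1:B\le A_2:B$; (6) $\operatorname{ran}(A:B)^{1/2}=\operatorname{ran}A^{1/2}\cap\operatorname{ran}B^{1/2}$; (7) $A:B=0$ (i.e. $\operatorname{dom}(A:B)=\mathcal H$ and $(A:B)f=0$ for all $f\in\mathcal H$) if and only if $\operatorname{ran}A^{1/2}\cap\operatorname{ran}B^{1/2}=\{0\}$; (8) if the quadratic form $A^{-1}[\cdot]$ is a closed restriction of the quadratic form $B^{-1}[\cdot]$ (i.e. $\mathcal D[A^{-1}]\subseteq\mathcal D[B^{-1}]$ and the two forms agree on $\mathcal D[A^{-1}]$), then $h(A,B)=A$. Besides, $$A:B=\operatorname{s-R-}\lim_{n\to\infty}\Big(\big(A+\tfrac1nI\big):\big(B+\tfrac1nI\big)\Big)=\operatorname{s-R-}\lim_{n\to\infty}\Big(\big(A+\tfrac1nI\big)^{-1}+\big(B+\tfrac1nI\big)^{-1}\Big)^{-1}.$$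
   Context: A linear relation (l.r.) in $\mathcal H$ is a closed linear subspace $A=\{\{f,f'\}\}$ of $\mathcal H\oplus\mathcal H$; $\operatorname{dom}A$, $\operatorname{ran}A$ are the sets of first, resp. second, components; $\operatorname{mul}A=\{f':\{0,f'\}\in A\}$; $A^{-1}=\{\{f',f\}:\{f,f'\}\in A\}$; $\lambda A=\{\{f,\lambda f'\}\}$; $A+cI=\{\{f,f'+cf\}\}$. $A$ is selfadjoint if $A=A^*:=\{\{g,g'\}:(f',g)=(f,g')\ \forall\{f,f'\}\in A\}$, nonnegative if $(f',f)\ge0$ for all $\{f,f'\}\in A$. A nonnegative selfadjoint l.r. decomposes as $A=\mathrm{Graph}(A_o)\oplus(\{0\}\oplus\operatorname{mul}A)$ with $A_o$ a nonnegative selfadjoint operator in $\mathcal H\ominus\operatorname{mul}A$. Put $A^{1/2}=\mathrm{Graph}(A_o^{1/2})\oplus(\{0\}\oplus\operatorname{mul}A)$, so $\operatorname{ran}A^{1/2}=\operatorname{ran}A_o^{1/2}\oplus\operatorname{mul}A$. The closed form of $A$ is $A[\varphi]=\|A_o^{1/2}\varphi\|^2$, $\varphi\in\mathcal D[A]=\operatorname{dom}A_o^{1/2}$; this gives a bijection between nonnegative selfadjoint l.r. and closed nonnegative (not necessarily densely defined) forms, and $\mathcal D[A^{-1}]=\operatorname{ran}A^{1/2}$. The order $A_1\ge A_2$ means $\mathcal D[A_1]\subseteq\mathcal D[A_2]$ and $A_1[\varphi]\ge A_2[\varphi]$ for all $\varphi\in\mathcal D[A_1]$. The form sum $A\dot+B$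 is the nonnegative selfadjoint l.r. associated with the closed form $A[\varphi]+B[\varphi]$, $\varphi\in\mathcal D[A]\cap\mathcal D[B]$. The parallel sum is $A:B:=(A^{-1}\dot+B^{-1})^{-1}$, and the harmonic mean is $h(A,B):=2(A:B)=\big(\tfrac12(A^{-1}\dot+B^{-1})\big)^{-1}$. $\operatorname{s-R-}\lim A_n=A$ means $(A_n+I)^{-1}\to(A+I)^{-1}$ strongly. *)

(* Defs.v *)
From HB Require Import structures.
From mathcomp Require Import all_boot all_order all_algebra.
From mathcomp Require Import complex.
From mathcomp Require Import all_classical all_reals all_analysis.

Set Implicit Arguments.
Unset Strict Implicit.
Unset Printing Implicit Defensive.

Import Order.TTheory GRing.Theory Num.Theory.
Import numFieldNormedType.Exports.

Local Open Scope complex_scope.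
Local Open Scope classical_set_scope.
Local Open Scope ring_scope.

(* [ip] is linear in its first argument and conjugate-linear in the second.
   The norm of a normed module over R[i] takes its values in R[i]; for
   z : R[i], [0 <= z] says that z is real and nonnegative. *)
Record hilbertSpace (R : realType) := HilbertSpace {
  hilbert_carrier :> completeNormedModType R[i];
  ip : {dot hilbert_carrier for Num.conj};
  ip_norm : forall x : hilbert_carrier, ip x x = `|x| ^+ 2
}.

Section LinearRelations.
Variables (R : realType) (H : hilbertSpace R).

Local Notation rel := (set (H * H)).

Definition linear_relation (A : rel) : Prop :=
  GRing.submod_closed [in A] /\ closed A.

Definition lr_dom (A : rel) : set H := [set f | exists f', A (f, f')].
Definition lr_ran (A : rel) : set H := [set f' | exists f, A (f, f')].
Definition lr_mul (A : rel) : set H := [set f' | A (0, f')].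

Definition lr_inv (A : rel) : rel := [set p | A (p.2, p.1)].

Definition lr_scale (c : R) (A : rel) : rel :=
  [set (p.1, c%:C *: p.2) | p in A].

Definition lr_shift (A : rel) (c : R) : rel :=
  [set (p.1, p.2 + c%:C *: p.1) | p in A].

Definition lr_add (A B : rel) : rel :=
  [set p | exists f' f'', [/\ A (p.1, f'), B (p.1, f'') & p.2 = f' + f'']].

Definition lr_comp (A B : rel) : rel :=
  [set p | exists g, B (p.1, g) /\ A (g, p.2)].

Definition lr_zero : rel := [set p | p.2 = 0].

(* The value at f of a relation that is (the graph of) an operator;
   0 outside the domain. *)
Definition lr_app (T : rel) (f : H) : H := xget 0 [set g | T (f, g)].

Definition lr_adj (A : rel) : rel :=
  [set q | forall p, A p -> ip H p.2 q.1 = ip H p.1 q.2].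

Definition lr_nonneg (A : rel) : Prop := forall p, A p -> 0 <= ip H p.2 p.1.

Definition nonneg_selfadjoint (A : rel) : Prop :=
  [/\ linear_relation A, lr_adj A = A & lr_nonneg A].

Definition ortho_compl (K : set H) : set H :=
  [set f | forall m, K m -> ip H f m = 0].

(* The orthogonal complement of {0} (+) mul A in A. *)
Definition lr_op (A : rel) : rel := [set p | A p /\ ortho_compl (lr_mul A) p.2].

(* S is a nonnegative selfadjoint operator in the subspace K; the adjoint is
   the one taken in K. *)
Definition nonneg_selfadjoint_op_in (K : set H) (S : rel) : Prop :=
  [/\ linear_relation S, lr_adj S `&` (K `*` K) = S, lr_nonneg S &
      lr_mul S = [set 0]].

(* A_o^{1/2}: the nonnegative selfadjoint operator in H (-) mul A whose square
   is A_o. *)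
Definition lr_op_sqrt (A : rel) : rel :=
  xget set0 [set S | nonneg_selfadjoint_op_in (ortho_compl (lr_mul A)) S /\
                     lr_comp S S = lr_op A].

Definition lr_sqrt (A : rel) : rel :=
  [set p | exists g m, [/\ lr_op_sqrt A (p.1, g), lr_mul A m & p.2 = g + m]].

Definition form_dom (A : rel) : set H := lr_dom (lr_op_sqrt A).

Definition lr_form (A : rel) (phi : H) : R[i] :=
  `|lr_app (lr_op_sqrt A) phi| ^+ 2.

Definition lr_le (A1 A2 : rel) : Prop :=
  form_dom A2 `<=` form_dom A1 /\
  forall phi, form_dom A2 phi -> lr_form A1 phi <= lr_form A2 phi.

(* The nonnegative selfadjoint relation whose closed form is q with domain D;
   it exists and is unique when q is closed and nonnegative. *)
Definition lr_of_form (D : set H) (q : H -> R[i]) : rel :=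
  xget set0 [set T | [/\ nonneg_selfadjoint T, form_dom T = D &
                         forall phi, D phi -> lr_form T phi = q phi]].

Definition form_sum (A B : rel) : rel :=
  lr_of_form (form_dom A `&` form_dom B)
             (fun phi => lr_form A phi + lr_form B phi).

Definition form_sum3 (A B C : rel) : rel :=
  lr_of_form (form_dom A `&` form_dom B `&` form_dom C)
             (fun phi => lr_form A phi + lr_form B phi + lr_form C phi).

Definition psum (A B : rel) : rel := lr_inv (form_sum (lr_inv A) (lr_inv B)).

Definition hmean (A B : rel) : rel := lr_scale 2 (psum A B).

Definition sR_lim (A_ : nat -> rel) (A : rel) : Prop :=
  forall f : H, (fun n => lr_app (lr_inv (lr_shift (A_ n) 1)) f) @ \oo -->
                lr_app (lr_inv (lr_shift A 1)) f.

End LinearRelations.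

Arguments lr_zero {R} H _ : assert.

(* Main.v *)
(* Everything is done with the real inner product Re (f, g): a complex linear
   relation is selfadjoint iff it is so for the real one.  A nonnegative
   selfadjoint relation A is determined by its resolvent R = (A + 1)^-1, which
   satisfies 0 <= R <= 1; the resolvent of A^-1 is 1 - R, and commuting square
   roots T of R and W of 1 - R give A^{1/2} as {T h, W h}.

   A closed form q on D is recovered from the resolvent by
     D = {x : |(h, x)|^2 <= c (R h, h) for some c and all h},
   the least such c being q[x] + |x|^2.  Hence a form is determined by its
   relation, and the order of forms is the reverse order of the resolvents;
   since R becomes 1 - R, inversion is antitone.  As A : B is the inverse of the
   form sum of A^-1 and B^-1, properties (1)-(8) become statements on forms.

   For the limit, write the resolvent of the perturbed form sum at h as
   phi_n = h - fA_n - fB_n, with {fA_n, phi_n} in A + 1/n and {fB_n, phi_n} in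
   B + 1/n.  The energy of the differences of the phi_n - fA_n / n (for A^-1),
   of the phi_n - fB_n / n (for B^-1) and of the phi_n is bounded by
   (phi_n, h) - (phi_m, h) for n <= m.  These numbers decrease, so all the
   sequences are Cauchy in form norm, and the limit solves the weak equation of
   the form sum. *)

Require Import Defs.
From HB Require Import structures.
From mathcomp Require Import all_boot all_order all_algebra.
From mathcomp Require Import complex.
From mathcomp Require Import all_classical all_reals all_analysis.
From mathcomp Require Import ring lra.

Set Implicit Arguments.
Unset Strict Implicit.
Unset Printing Implicit Defensive.

Import Order.TTheory GRing.Theory Num.Theory.
Import numFieldNormedType.Exports.

Local Open Scope classical_set_scope.
Local Open Scope ring_scope.

Local Open Scope complex_scope.

(** * Semidefinite forms and minimizing sequences *)

Section SemidefiniteForms.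
Variable R : realType.

(** Serves twice: with [e = a y y] it gives Cauchy-Schwarz, and with [e = 1/(n+1)] it bounds the
    error of a near-minimizer. *)
Lemma discriminant_le (a b e : R) : 0 <= e ->
  (forall t : R, 0 <= t ^+ 2 * a + 2 * t * b + e) -> b ^+ 2 <= a * e.
Proof.
move=> e0 h; have [a0|a0|a0] := ltgtP a 0.
(* Adding the inequalities at [t] and [- t] removes [b] and leaves [t ^+ 2 * (- a) <= e]; but
   [t * (- a) = e - a] and [1 <= t] make the left side exceed [e]. *)
- exfalso; pose t := 1 + e / (- a).
  have na : 0 < - a by rewrite oppr_gt0.
  have ts : t * (- a) = e - a by rewrite /t; field; rewrite lt_eqF.
  have t1 : 1 <= t by rewrite lerDl divr_ge0// ltW.
  have := h t; have := h (- t); nra.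
- have := h (- b / a).
  rewrite (_ : _ + e = (a * e - b ^+ 2) / a); last first.
    by field; rewrite gt_eqF.
  by rewrite pmulr_lge0 ?invr_gt0// subr_ge0.
- rewrite a0 mul0r; have [->|b0] := eqVneq b 0; first by rewrite expr0n.
  have := h (- (e + 1) / (2 * b)); rewrite a0 mulr0 add0r.
  rewrite (_ : _ + e = -1); first by rewrite lerNr oppr0 ler10.
  by field; rewrite b0.
Qed.

Lemma sqr_le_le (x y : R) : 0 <= y -> x ^+ 2 <= y ^+ 2 -> x <= y.
Proof. by move=> y0 h; have [//|lt] := leP x y; exfalso; nra. Qed.

Lemma sqr_le_cvg0 (c : R) (e X : nat -> R) :
  (forall n, X n ^+ 2 <= c * e n) -> e @ \oo --> (0 : R) -> X @ \oo --> (0 : R).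
Proof.
move=> Xe e0; apply/cvgr0Pnorm_le => d d0.
have /cvgr0Pnorm_le/(_ (d ^+ 2)) : (fun n => c * e n) @ \oo --> (0 : R).
  by rewrite -[X in _ --> X](mulr0 c); apply: cvgMr.
rewrite exprn_gt0// => /(_ isT); apply: filterS => n hn.
apply: sqr_le_le; first exact: ltW.
rewrite real_normK ?num_real//.
by apply: le_trans (Xe n) _; exact: le_trans (ler_norm _) hn.
Qed.

Lemma cvg_invn : (fun n => n.+1%:R^-1 : R) @ \oo --> (0 : R).
Proof. exact: cvg_harmonic. Qed.

Lemma bounded_invn_small (c e : R) : 0 < e ->
  exists N, forall n, (N <= n)%N -> c * n.+1%:R^-1 <= e.
Proof.
move=> e0; have : (fun n => c * n.+1%:R^-1 : R) @ \oo --> (0 : R).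
  by rewrite -[X in _ --> X](mulr0 c); apply: cvgMr; exact: cvg_invn.
move=> /cvgr0Pnorm_le /(_ _ e0) [N _ hN]; exists N => n /hN /=.
exact/le_trans/ler_norm.
Qed.

Variable V : lmodType R[i].
Implicit Types (D : set V) (a : V -> V -> R).

Definition csubmod D := D 0 /\ forall c x y, D x -> D y -> D (c *: x + y).

(** Bilinear over the reals only, being meant as the real part of a sesquilinear form; the domain is
    nevertheless a complex subspace. *)
Definition semidef_form D a : Prop :=
  [/\ csubmod D,
      forall x y, D x -> D y -> a x y = a y x,
      forall (t : R) x y z, D x -> D y -> D z ->
        a (t%:C *: x + y) z = t * a x z + a y z &
      forall x, D x -> 0 <= a x x].

Definition form_cauchy a (u : nat -> V) := forall e : R, 0 < e ->
  exists N, forall m n, (N <= m)%N -> (N <= n)%N ->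
    a (u m - u n) (u m - u n) <= e.

Definition form_cvg a (u : nat -> V) (x : V) :=
  (fun n => a (u n - x) (u n - x)) @ \oo --> (0 : R).

Definition form_complete D a := forall u, (forall n, D (u n)) ->
  form_cauchy a u -> exists2 x, D x & form_cvg a u x.

Lemma csubmodD D x y : csubmod D -> D x -> D y -> D (x + y).
Proof. by move=> [_ h] Dx Dy; rewrite -[x]scale1r; exact: h. Qed.

Lemma csubmodZ D c x : csubmod D -> D x -> D (c *: x).
Proof. by move=> [D0 h] Dx; rewrite -[_ *: _]addr0; exact: h. Qed.

Lemma csubmodB D x y : csubmod D -> D x -> D y -> D (x - y).
Proof.
by move=> s Dx Dy; apply: csubmodD => //; rewrite -scaleN1r; exact: csubmodZ.
Qed.

Lemma csubmodP D : GRing.submod_closed [in D] <-> csubmod D.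
Proof.
split=> [[D0 DD]|[D0 DD]].
  split=> [|c x y Dx Dy]; first by move: D0; rewrite inE.
  by have := DD c x y; rewrite !inE; apply.
by split=> [|c x y]; rewrite !inE//; exact: DD.
Qed.

Section Theory.
Variables (D : set V) (a : V -> V -> R).
Hypothesis Da : semidef_form D a.

Let Ds : csubmod D. Proof. by case: Da. Qed.

Lemma semidef_sym x y : D x -> D y -> a x y = a y x.
Proof. by case: Da => _ h _ _; exact: h. Qed.

Lemma semidefPl t x y z : D x -> D y -> D z ->
  a (t%:C *: x + y) z = t * a x z + a y z.
Proof. by case: Da => _ _ h _; exact: h. Qed.

Lemma semidef_ge0 x : D x -> 0 <= a x x.
Proof. by case: Da => _ _ _; exact. Qed.

Lemma semidefDl x y z : D x -> D y -> D z -> a (x + y) z = a x z + a y z.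
Proof.
by move=> Dx Dy Dz; have := semidefPl 1 Dx Dy Dz; rewrite scale1r mul1r.
Qed.

Lemma semidef0l z : D z -> a 0 z = 0.
Proof.
case: Ds => D0 _ Dz; have := semidefDl D0 D0 Dz; rewrite addr0 => h.
by apply/(@addrI _ (a 0 z)); rewrite -h addr0.
Qed.

Lemma semidefZl t x z : D x -> D z -> a (t%:C *: x) z = t * a x z.
Proof.
case: Ds => D0 _ Dx Dz; have := semidefPl t Dx D0 Dz.
by rewrite semidef0l// !addr0.
Qed.

Lemma semidefBl x y z : D x -> D y -> D z -> a (x - y) z = a x z - a y z.
Proof.
move=> Dx Dy Dz; have := semidefPl (-1) Dy Dx Dz.
by rewrite rmorphN1 scaleN1r mulN1r addrC => ->; rewrite addrC.
Qed.

Lemma semidefBr x y z : D x -> D y -> D z -> a z (x - y) = a z x - a z y.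
Proof.
move=> Dx Dy Dz; have Dxy := csubmodB Ds Dx Dy.
by rewrite semidef_sym// semidefBl// ![a _ z]semidef_sym.
Qed.

Lemma semidefDr x y z : D x -> D y -> D z -> a z (x + y) = a z x + a z y.
Proof.
move=> Dx Dy Dz; have Dxy := csubmodD Ds Dx Dy.
by rewrite semidef_sym// semidefDl// ![a _ z]semidef_sym.
Qed.

Lemma semidefZr t x z : D x -> D z -> a z (t%:C *: x) = t * a z x.
Proof.
move=> Dx Dz; have Dt := csubmodZ t%:C Ds Dx.
by rewrite semidef_sym// semidefZl// semidef_sym.
Qed.

Lemma semidef_sqr t x y : D x -> D y ->
  a (t%:C *: x + y) (t%:C *: x + y) = t ^+ 2 * a x x + 2 * t * a x y + a y y.
Proof.
move=> Dx Dy; have Dtx := csubmodZ t%:C Ds Dx; have Dz := csubmodD Ds Dtx Dy.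
rewrite semidefDl// semidefZl// !semidefDr// semidefZr// semidefZr//.
rewrite [a y x]semidef_sym//.
by ring.
Qed.

Lemma semidefB_sqr x y : D x -> D y ->
  a (x - y) (x - y) = a x x - 2 * a x y + a y y.
Proof.
move=> Dx Dy; have Dz := csubmodB Ds Dx Dy.
by rewrite semidefBl// !semidefBr// [a y x]semidef_sym//; ring.
Qed.

Lemma semidef_swap x y : D x -> D y -> a (x - y) (x - y) = a (y - x) (y - x).
Proof. by move=> Dx Dy; rewrite !semidefB_sqr// [a y x]semidef_sym//; ring. Qed.

Lemma form_cauchy_le u : (forall n, D (u n)) ->
  (forall e : R, 0 < e -> exists N, forall n m, (N <= n)%N -> (n <= m)%N ->
    a (u n - u m) (u n - u m) <= e) ->
  form_cauchy a u.
Proof.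
move=> Du h e /h[N hN]; exists N => m n Nm Nn.
have [|/ltnW] := leqP m n; first exact: hN.
by rewrite semidef_swap//; exact: hN.
Qed.

Lemma semidef_CS x y : D x -> D y -> a x y ^+ 2 <= a x x * a y y.
Proof.
move=> Dx Dy; apply: discriminant_le; first exact: semidef_ge0.
move=> t; rewrite -semidef_sqr//; apply: semidef_ge0.
by apply: csubmodD => //; exact: csubmodZ.
Qed.

Lemma form_cvg_pair u x y : (forall n, D (u n)) -> D x -> D y ->
  form_cvg a u x -> (fun n => a y (u n)) @ \oo --> a y x.
Proof.
move=> Du Dx Dy ux; apply/subr_cvg0.
apply: (@sqr_le_cvg0 (a y y) _ _ _ ux) => n /=.
rewrite -[_ - _]/(a y (u n) - a y x) -semidefBr//.
by apply: semidef_CS => //; exact: csubmodB.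
Qed.

Lemma form_cvg_sqr u x : (forall n, D (u n)) -> D x ->
  form_cvg a u x -> (fun n => a (u n) (u n)) @ \oo --> a x x.
Proof.
move=> Du Dx ux.
have -> : (fun n => a (u n) (u n)) =
    (fun n => a (u n - x) (u n - x) + 2 * a x (u n) - a x x).
  by apply/funext => n; rewrite semidefB_sqr// [a x (u n)]semidef_sym//; ring.
rewrite [X in _ --> X](_ : _ = 0 + 2 * a x x - a x x); last by ring.
apply: cvgB; last exact: cvg_cst.
by apply: cvgD => //; apply: cvgMr; exact: form_cvg_pair.
Qed.

(* The minimizing sequence of [x |-> a x x - 2 * l x]; no completeness is
   needed for it to be Cauchy. *)
Lemma riesz_sequence (l : V -> R) (c : R) :
  (forall t x y, D x -> D y -> l (t%:C *: x + y) = t * l x + l y) ->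
  (forall x, D x -> l x ^+ 2 <= c * a x x) ->
  exists u : nat -> V, [/\ forall n, D (u n),
    form_cauchy a u &
    forall y, D y -> (fun n => a y (u n)) @ \oo --> l y].
Proof.
move=> llin lbd; pose J x := a x x - 2 * l x.
have D0 : D 0 by case: Ds.
(* By the arithmetic-geometric mean inequality, [2 * l x] is at most [a x x + |c|]. *)
have Jlb x : D x -> - `|c| <= J x.
  move=> Dx; have := lbd _ Dx; have := semidef_ge0 Dx; rewrite /J => a0 lc.
  have lc' : l x ^+ 2 <= `|c| * a x x.
    by apply: le_trans lc _; rewrite ler_wpM2r// ler_norm.
  have c0 := normr_ge0 c.
  have : (2 * l x) ^+ 2 <= (a x x + `|c|) ^+ 2.
    have := sqr_ge0 (a x x - `|c|); nra.
  have s0 : 0 <= a x x + `|c| by lra.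
  by move=> h; have := sqr_le_le s0 h; lra.
pose E := [set J x | x in D].
have infE : has_inf E.
  split; first by exists (J 0); exists 0.
  by exists (- `|c|) => _ [x Dx <-]; exact: Jlb.
have /choice[u hu] : forall n : nat, exists x, D x /\ J x < inf E + n.+1%:R^-1.
  move=> n; have [|_ [x Dx <-] h] := @inf_adherent _ E n.+1%:R^-1 _ infE.
    by rewrite invr_gt0.
  by exists x.
have Du n : D (u n) by case: (hu n).
have mJ x : D x -> inf E <= J x.
  by move=> Dx; apply: ge_inf; [case: infE|exists x].
have JD t x y : D x -> D y -> J (t%:C *: x + y) =
    J y + 2 * t * (a x y - l x) + t ^+ 2 * a x x.
  by move=> Dx Dy; rewrite /J semidef_sqr// llin//; ring.
exists u; split=> //.
(* The parallelogram identity, with [J] at the midpoint bounded below by [inf E], bounds the form of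
   [u m - u n] by [2/(m+1) + 2/(n+1)], each term being at most [e / 2]. *)
- move=> e e0; have [N hN] := @bounded_invn_small 4 e e0.
  exists N => m n Nm Nn; have [_ um] := hu m; have [_ un] := hu n.
  have Dx := csubmodD Ds (Du m) (Du n).
  have := mJ _ (csubmodZ (2^-1)%:C Ds Dx).
  have := JD 2^-1 _ _ Dx D0; rewrite addr0 => ->.
  have := hN _ Nm; have := hN _ Nn; rewrite semidefB_sqr//.
  have l0 : l 0 = 0.
    by have := llin 1 0 0 D0 D0; rewrite scaler0 addr0 mul1r => h; lra.
  have ld : l (u m + u n) = l (u m) + l (u n).
    by have := llin 1 _ _ (Du m) (Du n); rewrite scale1r mul1r.
  have ad := semidef_sqr 1 (Du m) (Du n); rewrite scale1r in ad.
  move: um un; rewrite ad ld /J (semidef0l D0) l0 semidef_sym// semidef0l//.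
  move: (m.+1%:R^-1) (n.+1%:R^-1) (inf E) => em en i.
  have -> : 2^-1 ^+ 2 = 4^-1 :> R by field.
  lra.
(* As [u n] minimizes [J] up to [1/(n+1)], the variation of [J] along [t y] plus [1/(n+1)] is
   nonnegative for all [t]; so the squared middle coefficient is at most [a y y / (n+1)]. *)
- move=> y Dy; apply/subr_cvg0.
  apply: (@sqr_le_cvg0 (a y y) _ _ _ cvg_invn) => n /=.
  rewrite -[_ - _]/(a y (u n) - l y).
  apply: discriminant_le; first by rewrite invr_ge0.
  move=> t; have := mJ _ (csubmodD Ds (csubmodZ t%:C Ds Dy) (Du n)).
  rewrite JD//; have [_] := hu n.
  by move: (n.+1%:R^-1) (inf E) (J (u n)) => en i j; lra.
Qed.

(** The limit of the minimizing sequence represents [l]. The form may be degenerate, so uniqueness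
    is not claimed. *)
Lemma riesz (l : V -> R) (c : R) : form_complete D a ->
  (forall t x y, D x -> D y -> l (t%:C *: x + y) = t * l x + l y) ->
  (forall x, D x -> l x ^+ 2 <= c * a x x) ->
  exists2 x, D x & forall y, D y -> a y x = l y.
Proof.
move=> comp llin lbd; have [u [Du uc ul]] := riesz_sequence llin lbd.
have [x Dx ux] := comp u Du uc; exists x => // y Dy.
exact: cvg_unique (form_cvg_pair Du Dx Dy ux) (ul y Dy).
Qed.

End Theory.
End SemidefiniteForms.
(** * The real inner product *)

Section RealInnerProduct.
Variables (R : realType) (H : hilbertSpace R).
Implicit Types x y z : H.

Definition rip x y : R := complex.Re (ip H x y).

Lemma ipC x y : ip H x y = (ip H y x)^*.
Proof. by rewrite (@hermC _ _ _ _ (ip H)) expr0 mul1r. Qed.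

Lemma ripC x y : rip x y = rip y x.
Proof. by rewrite /rip ipC; case: (ip H y x). Qed.

Lemma ripDl x y z : rip (x + y) z = rip x z + rip y z.
Proof. by rewrite /rip linearDl raddfD. Qed.

Lemma ripDr x y z : rip z (x + y) = rip z x + rip z y.
Proof. by rewrite ![rip z _]ripC ripDl. Qed.

Lemma ripZl (t : R) x y : rip (t%:C *: x) y = t * rip x y.
Proof. by rewrite /rip linearZl_LR /=; case: (ip H x y) => a b /=; ring. Qed.

Lemma ripZr (t : R) x y : rip y (t%:C *: x) = t * rip y x.
Proof. by rewrite ripC ripZl ripC. Qed.

Lemma ripNl x y : rip (- x) y = - rip x y.
Proof. by rewrite -scaleN1r -(rmorphN1 (real_complex R)) ripZl mulN1r. Qed.

Lemma ripNr x y : rip y (- x) = - rip y x.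
Proof. by rewrite ripC ripNl ripC. Qed.

Lemma ripBl x y z : rip (x - y) z = rip x z - rip y z.
Proof. by rewrite ripDl ripNl. Qed.

Lemma ripBr x y z : rip z (x - y) = rip z x - rip z y.
Proof. by rewrite ripDr ripNr. Qed.

Lemma rip0l x : rip 0 x = 0.
Proof. by rewrite -(scale0r 0) -(rmorph0 (real_complex R)) ripZl mul0r. Qed.

Lemma rip0r x : rip x 0 = 0.
Proof. by rewrite ripC rip0l. Qed.

(** Multiplication by [i] exposes the imaginary part, so on complex subspaces the real inner product
    loses no information. *)
Lemma Re_ip_i x y : rip ('i%C *: x) y = - complex.Im (ip H x y).
Proof. by rewrite /rip linearZl_LR /=; case: (ip H x y) => a b /=; ring. Qed.

Lemma Im_ipC x y : complex.Im (ip H x y) = - complex.Im (ip H y x).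
Proof. by rewrite ipC; case: (ip H y x). Qed.

Lemma rip_ii x y : rip ('i%C *: x) ('i%C *: y) = rip x y.
Proof.
rewrite Re_ip_i Im_ipC opprK linearZl_LR /= ripC /rip.
by case: (ip H y x) => a b /=; ring.
Qed.

Lemma rip_ir x y : rip x ('i%C *: y) = - rip ('i%C *: x) y.
Proof.
by rewrite -rip_ii scalerA -expr2 sqr_i scaleN1r ripNr.
Qed.

Lemma ip_eq x y x' y' : rip x y = rip x' y' ->
  rip ('i%C *: x) y = rip ('i%C *: x') y' -> ip H x y = ip H x' y'.
Proof.
rewrite !Re_ip_i => re /oppr_inj im; apply/eqP; rewrite eq_complex.
by rewrite -/(rip x y) re im !eqxx.
Qed.

Lemma ip_self x : ip H x x = (rip x x)%:C.
Proof. by rewrite /rip RRe_real// ger0_real// ip_norm exprn_ge0. Qed.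

Lemma rip_ge0 x : 0 <= rip x x.
Proof. by rewrite -ler0c -ip_self ip_norm exprn_ge0. Qed.

Lemma rip_eq0 x : rip x x = 0 -> x = 0.
Proof.
by move=> x0; have := ip_norm x; rewrite ip_self x0 => /esym/eqP;
   rewrite expf_eq0 /= normr_eq0 => /eqP.
Qed.

Lemma rip_perp x : (forall y, rip y x = 0) -> x = 0.
Proof. by move=> h; apply: rip_eq0. Qed.

Lemma rip_ext x y : (forall z, rip z x = rip z y) -> x = y.
Proof.
move=> h; apply/eqP; rewrite -subr_eq0; apply/eqP/rip_perp => z.
by rewrite ripBr h subrr.
Qed.

Lemma rip_le0 x : rip x x <= 0 -> x = 0.
Proof. by move=> h; apply: rip_eq0; apply/eqP; rewrite eq_le h rip_ge0. Qed.

Lemma rip_semidef (D : set H) : csubmod D -> semidef_form D rip.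
Proof.
move=> Ds; split=> // [x y _ _|t x y z _ _ _|x _]; first exact: ripC.
  by rewrite ripDl ripZl.
exact: rip_ge0.
Qed.

Lemma csubmodT (V : lmodType R[i]) : csubmod [set: V].
Proof. by []. Qed.

Lemma rip_CS x y : rip x y ^+ 2 <= rip x x * rip y y.
Proof. exact: (semidef_CS (rip_semidef (@csubmodT H))). Qed.

Lemma ripD_sqr_le x y : rip (x + y) (x + y) <= 2 * rip x x + 2 * rip y y.
Proof.
have := rip_ge0 (x - y); rewrite !(ripBl, ripBr, ripDl, ripDr) [rip y x]ripC.
lra.
Qed.

Lemma norm_rip x : `|x| = (Num.sqrt (rip x x))%:C :> R[i].
Proof.
apply/eqP; rewrite -(@eqrXn2 _ 2)//; last by rewrite ler0c sqrtr_ge0.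
by rewrite -ip_norm ip_self -rmorphXn /= sqr_sqrtr// rip_ge0.
Qed.

Lemma normr_lt_rip x (e : R) : 0 < e -> (`|x| < e%:C) = (rip x x < e ^+ 2).
Proof.
move=> e0; rewrite norm_rip ltcR -{2}(sqr_sqrtr (rip_ge0 x)).
by rewrite ltr_pXn2r// ?nnegrE ?sqrtr_ge0// ltW.
Qed.

Lemma gt0_realC (e : R[i]) : 0 < e -> exists2 d : R, 0 < d & e = d%:C.
Proof.
move=> e0; exists (complex.Re e); last by rewrite RRe_real// gtr0_real.
by rewrite -ltcR RRe_real// gtr0_real.
Qed.

Lemma form_cvgE (u : nat -> H) x : form_cvg rip u x <-> u @ \oo --> x.
Proof.
split=> [ux|ux].
  apply/cvgrPdist_lt => _ /gt0_realC[e e0 ->].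
  have /cvgr0Pnorm_lt/(_ (e ^+ 2)) := ux; rewrite exprn_gt0// => /(_ isT).
  apply: filterS => n; rewrite distrC normr_lt_rip//.
  exact/le_lt_trans/ler_norm.
apply/cvgr0Pnorm_lt => e e0; have s0 : 0 < Num.sqrt e by rewrite sqrtr_gt0.
have /cvgrPdist_lt/(_ (Num.sqrt e)%:C) := ux; rewrite ltcR => /(_ s0).
apply: filterS => n; rewrite distrC normr_lt_rip// sqr_sqrtr ?ltW//.
by rewrite ger0_norm// rip_ge0.
Qed.

Lemma rip_complete (u : nat -> H) : form_cauchy rip u ->
  exists x, form_cvg rip u x.
Proof.
move=> uc; suff : cvgn u.
  by move=> /cvg_ex[x ux]; exists x; apply/form_cvgE.
apply: cauchy_cvg; apply: cauchy_exP => _ /gt0_realC[e e0 ->].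
have [|N hN] := uc (e ^+ 2 / 2); first by rewrite divr_gt0// exprn_gt0.
exists (u N), N => // n /= Nn; rewrite -ball_normE /= normr_lt_rip//.
have := hN N n (leqnn N) Nn; have := exprn_gt0 2 e0; lra.
Qed.

Lemma form_cvg_uniq (u : nat -> H) x y :
  form_cvg rip u x -> form_cvg rip u y -> x = y.
Proof. by move=> /form_cvgE ux /form_cvgE; exact: norm_cvg_unique. Qed.

Lemma closed_prodP (A : set (H * H)) : closed A <->
  forall p, (forall e : R, 0 < e -> exists2 q, A q &
    rip (p.1 - q.1) (p.1 - q.1) < e /\ rip (p.2 - q.2) (p.2 - q.2) < e) -> A p.
Proof.
split=> [Ac p hp|hA p cp].
  apply: Ac => U /nbhs_ballP[_ /= /gt0_realC[e e0 ->] eU].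
  have [|q Aq [q1 q2]] := hp (e ^+ 2); first exact: exprn_gt0.
  by exists q; split=> //; apply: eU; split;
    rewrite -ball_normE /= normr_lt_rip.
apply: hA => e e0; have s0 : 0 < Num.sqrt e by rewrite sqrtr_gt0.
have [|q [Aq [q1 q2]]] := cp (ball p (Num.sqrt e)%:C).
  by apply: nbhsx_ballx; rewrite ltcR.
exists q => //; move: q1 q2; rewrite -!ball_normE /= !normr_lt_rip//.
by rewrite sqr_sqrtr// ltW.
Qed.

Lemma closed_prod_seq (A : set (H * H)) (u v : nat -> H) x y : closed A ->
  (forall n, A (u n, v n)) -> form_cvg rip u x -> form_cvg rip v y -> A (x, y).
Proof.
move=> /closed_prodP Ac Auv /cvgr0Pnorm_lt ux /cvgr0Pnorm_lt vy.
apply: Ac => e e0 /=.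
near \oo => n; exists (u n, v n) => //=.
have sw z w : rip (z - w) (z - w) = rip (w - z) (w - z).
  by rewrite -opprB ripNl ripNr opprK.
split; rewrite sw; apply: le_lt_trans (ler_norm _) _; near: n.
  exact: ux.
exact: vy.
Unshelve. all: by end_near. Qed.

End RealInnerProduct.
Arguments rip {R H}.
(** * Selfadjoint relations *)

Section Relations.
Variables (R : realType) (H : hilbertSpace R).
Local Notation rel := (set (H * H)).
Implicit Types (A S : rel) (D K : set H).

Lemma cvg0_le (f g : nat -> R) : (forall n, 0 <= f n <= g n) ->
  g @ \oo --> (0 : R) -> f @ \oo --> (0 : R).
Proof.
by move=> fg g0; apply: (squeeze_cvgr _ (cvg_cst 0) g0); exact: nearW.
Qed.

Lemma sqr_le_small (x c : R) : (forall e, 0 < e -> x ^+ 2 <= c * e) -> x = 0.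
Proof.
move=> h; apply/eqP; rewrite -sqrf_eq0 eq_le sqr_ge0 andbT.
rewrite leNgt; apply/negP => x0.
have c0 : 0 < c by have := h 1 ltr01; lra.
have := h (x ^+ 2 / (2 * c)); have -> : 0 < x ^+ 2 / (2 * c) by rewrite divr_gt0// mulr_gt0.
move=> /(_ isT).
rewrite (_ : c * _ = x ^+ 2 / 2); last by field; rewrite gt_eqF.
lra.
Qed.

Lemma fst_lin (V : lmodType R[i]) c (x y : V * V) :
  (c *: x + y).1 = c *: x.1 + y.1.
Proof. by []. Qed.

Lemma snd_lin (V : lmodType R[i]) c (x y : V * V) :
  (c *: x + y).2 = c *: x.2 + y.2.
Proof. by []. Qed.

Lemma pair_lin (V : lmodType R[i]) c (x x' y y' : V) :
  c *: (x, x') + (y, y') = (c *: x + y, c *: x' + y').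
Proof. by []. Qed.

Lemma sum_lin (V : lmodType R[i]) c (x y : V * V) :
  (c *: x + y).1 + (c *: x + y).2 = c *: (x.1 + x.2) + (y.1 + y.2).
Proof. by rewrite fst_lin snd_lin scalerDr addrACA. Qed.

Lemma csubmod_realI (V : lmodType R[i]) (D : set V) : D 0 ->
  (forall t : R, forall x y, D x -> D y -> D (t%:C *: x + y)) ->
  (forall x, D x -> D ('i%C *: x)) -> csubmod D.
Proof.
move=> D0 Dt Di; split=> // c x y Dx Dy.
rewrite [c]complexE scalerDl -addrA mulrC -scalerA.
by apply: (Dt) => //; apply: Dt => //; exact: Di.
Qed.

Definition rip_adj A : rel :=
  [set q | forall p, A p -> rip p.2 q.1 = rip p.1 q.2].

Definition rip_nonneg A := forall p, A p -> 0 <= rip p.2 p.1.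

(** [A] contains [i p] along with [p], and the real identity at [i p] is the imaginary part of the
    complex identity at [p]. *)
Lemma lr_adjE A : csubmod A -> lr_adj A = rip_adj A.
Proof.
move=> As; apply/seteqP; split=> q hq p Ap.
  by rewrite /rip (hq p Ap).
by apply: ip_eq; [exact: hq|exact: (hq _ (csubmodZ 'i%C As Ap))].
Qed.

Lemma ortho_complE K : csubmod K ->
  ortho_compl K = [set f | forall m, K m -> rip f m = 0].
Proof.
move=> Ks; apply/seteqP; split=> f hf m Km; first by rewrite /rip hf.
rewrite -(linear0l (ip H) m); apply: ip_eq; first by rewrite rip0l hf.
rewrite scaler0 rip0l; apply/eqP; rewrite -oppr_eq0 -rip_ir hf//.
exact: csubmodZ.
Qed.

(** Symmetry applied to [p] and [i p] makes the imaginary part of [ip H p.2 p.1] vanish. *)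
Lemma lr_nonnegE A : csubmod A -> A `<=` rip_adj A ->
  lr_nonneg A <-> rip_nonneg A.
Proof.
move=> As Aadj; split=> hA p Ap.
  by have := hA p Ap; rewrite lecE => /andP[_].
rewrite lecE (hA p Ap) andbT.
have := Aadj _ Ap _ (csubmodZ 'i%C As Ap) => /=.
by rewrite !Re_ip_i Im_ipC => h; apply/eqP; lra.
Qed.

Lemma closed_rip_adj A : closed (rip_adj A).
Proof.
apply/closed_prodP => p hp s As; apply/eqP; rewrite -subr_eq0; apply/eqP.
apply: (@sqr_le_small _ (2 * (rip s.2 s.2 + rip s.1 s.1))) => e e0.
have [q Aq [q1 q2]] := hp e e0.
have -> : rip s.2 p.1 - rip s.1 p.2 = rip s.2 (p.1 - q.1) - rip s.1 (p.2 - q.2).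
  by rewrite !ripBr (Aq _ As); ring.
have := rip_CS s.2 (p.1 - q.1); have := rip_CS s.1 (p.2 - q.2).
have := rip_ge0 s.1; have := rip_ge0 s.2.
move: (rip s.2 (p.1 - q.1)) (rip s.1 (p.2 - q.2)) => x y s2 s1 hy hx.
have hx' := le_trans hx (ler_wpM2l s2 (ltW q1)).
have hy' := le_trans hy (ler_wpM2l s1 (ltW q2)).
have := sqr_ge0 (x + y); lra.
Qed.

Lemma nonneg_selfadjointP A : nonneg_selfadjoint A <->
  [/\ csubmod A, rip_adj A = A & rip_nonneg A].
Proof.
split=> [[[/csubmodP As _] Aadj An]|[As Aadj An]].
  have Aa : rip_adj A = A by rewrite -lr_adjE.
  by split=> //; apply/lr_nonnegE => //; rewrite Aa.
split; [split|by rewrite lr_adjE|]; first exact/csubmodP.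
  by rewrite -Aadj; exact: closed_rip_adj.
by apply/lr_nonnegE => //; rewrite Aadj.
Qed.

Lemma nsa_csubmod A : nonneg_selfadjoint A -> csubmod A.
Proof. by case/nonneg_selfadjointP. Qed.

Lemma nsa_sym A p q : nonneg_selfadjoint A -> A p -> A q ->
  rip p.2 q.1 = rip p.1 q.2.
Proof. by case/nonneg_selfadjointP => _ AE _ Ap; rewrite -{1}AE; exact. Qed.

Lemma nsa_ge0 A p : nonneg_selfadjoint A -> A p -> 0 <= rip p.2 p.1.
Proof. by case/nonneg_selfadjointP => _ _; exact. Qed.

Lemma nsa_adj A q : nonneg_selfadjoint A ->
  (forall p, A p -> rip p.2 q.1 = rip p.1 q.2) -> A q.
Proof. by case/nonneg_selfadjointP => _ AE _ h; rewrite -AE. Qed.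

Lemma nsa_closed A : nonneg_selfadjoint A -> closed A.
Proof. by case => -[]. Qed.

(** Surjectivity of [A + 1]. By nonnegativity the form [a] on [A] dominates the graph norm, so it is
    complete, and Riesz gives an element [q] of [A] whose sum of components differs from [h] by a
    vector orthogonal to [ran (A + 1)]. *)
Lemma nsa_resolvent A h : nonneg_selfadjoint A -> exists f, A (f, h - f).
Proof.
move=> nA; have As := nsa_csubmod nA.
pose a (p q : H * H) := rip (p.1 + p.2) (q.1 + q.2).
have aform : semidef_form A a.
  split=> // [p q _ _|t x y z _ _ _|x _].
  - exact: ripC.
  - by rewrite /a sum_lin (ripDl (_ *: _)) ripZl.
  - exact: rip_ge0.
have ale p : A p -> rip p.1 p.1 + rip p.2 p.2 <= a p p.
  move=> Ap; have := nsa_ge0 nA Ap.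
  by rewrite /a ripDl !ripDr [rip p.1 p.2]ripC; lra.
have acomp : form_complete A a.
  move=> u Au uc.
  have u1c : form_cauchy rip (fun n => (u n).1).
    move=> e /uc[N hN]; exists N => m n Nm Nn.
    have := ale _ (csubmodB As (Au m) (Au n)).
    have := hN _ _ Nm Nn; have := rip_ge0 (u m - u n).2 => /=; lra.
  have u2c : form_cauchy rip (fun n => (u n).2).
    move=> e /uc[N hN]; exists N => m n Nm Nn.
    have := ale _ (csubmodB As (Au m) (Au n)).
    have := hN _ _ Nm Nn; have := rip_ge0 (u m - u n).1 => /=; lra.
  have [x ux] := rip_complete u1c; have [y uy] := rip_complete u2c.
  exists (x, y).
    apply: (closed_prod_seq (nsa_closed nA) _ ux uy) => n.
    by rewrite -surjective_pairing.
  pose g n := 2 * rip ((u n).1 - x) ((u n).1 - x) +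
              2 * rip ((u n).2 - y) ((u n).2 - y).
  apply: (@cvg0_le _ g) => [n|].
    by rewrite rip_ge0 /=; exact: ripD_sqr_le.
  rewrite [X in _ --> X](_ : 0 = 2 * 0 + 2 * 0); last by ring.
  by apply: cvgD; exact: cvgMr.
have [||q Aq hq] := riesz aform (l := fun p => rip (p.1 + p.2) h)
    (c := rip h h) acomp.
- by move=> t x y _ _; rewrite sum_lin (ripDl (_ *: _)) ripZl.
- by move=> x _; rewrite mulrC; exact: rip_CS.
pose g := q.1 + q.2 - h.
(* Orthogonality of [g] to every [p.1 + p.2] says that [(g, - g)] is in the adjoint, which is [A];
   nonnegativity then kills [g]. *)
have Ag : A (g, - g).
  apply: nsa_adj => // p Ap /=; apply/eqP; rewrite ripNr -addr_eq0 -ripDl.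
  by rewrite addrC /g ripBr -[rip _ (_ + _)]/(a p q) hq// subrr.
have g0 : g = 0.
  by apply: rip_le0; have := nsa_ge0 nA Ag; rewrite /= ripNl oppr_ge0.
exists q.1; rewrite (_ : h - q.1 = q.2) -?surjective_pairing//.
by apply/esym/eqP; rewrite eq_sym subr_eq addrC eq_sym -subr_eq0; apply/eqP.
Qed.

(** Given [q] in the adjoint, the element of [A] with the same sum of components differs from [q] by
    some [(d, - d)]. Testing this against an element of [A] whose components sum to [d] yields
    [rip d d = 0]. *)
Lemma nsa_intro A : csubmod A ->
  (forall p q, A p -> A q -> rip p.2 q.1 = rip p.1 q.2) -> rip_nonneg A ->
  (forall h, exists f, A (f, h - f)) -> nonneg_selfadjoint A.
Proof.
move=> As Asym A0 Ares; apply/nonneg_selfadjointP; split=> //.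
apply/seteqP; split=> [q hq|q Aq p Ap]; last exact: Asym.
have [f Af] := Ares (q.1 + q.2).
have [g Ag] := Ares (q.1 - f).
have d0 : q.1 - f = 0.
  apply: rip_eq0; have := hq _ Ag; have := Asym _ _ Ag Af => /=.
  by rewrite !(ripBl, ripBr, ripDl, ripDr, ripNl, ripNr); lra.
move/eqP: d0; rewrite subr_eq0 => /eqP d0.
by move: Af; rewrite -d0 addrC addKr -surjective_pairing.
Qed.

Lemma nsa_inv A : nonneg_selfadjoint A -> nonneg_selfadjoint (lr_inv A).
Proof.
move=> nA; have As := nsa_csubmod nA; apply: nsa_intro.
- case: As => A0 AD; split=> // c x y Ax Ay; exact: (AD c _ _ Ax Ay).
- by move=> p q Ap Aq; have /= -> := nsa_sym nA Ap Aq.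
- by move=> p Ap; rewrite ripC; exact: (nsa_ge0 nA Ap).
- move=> h; have [f Af] := nsa_resolvent h nA; exists (h - f).
  by rewrite /lr_inv /= subKr.
Qed.

Lemma csubmod_mul A : csubmod A -> csubmod (lr_mul A).
Proof.
move=> [A0 AD]; split=> // c u v Au Av.
by have := AD c _ _ Au Av; rewrite pair_lin scaler0 addr0.
Qed.

Lemma nsa_proj A : nonneg_selfadjoint A -> forall x, exists2 m, lr_mul A m &
  forall m', lr_mul A m' -> rip (x - m) m' = 0.
Proof.
move=> nA x; have As := nsa_csubmod nA.
have Ms := csubmod_mul As.
have Mform := rip_semidef Ms.
have Mcomp : form_complete (lr_mul A) rip.
  move=> u Mu uc; have [y uy] := rip_complete uc; exists y => //.
  apply: (closed_prod_seq (u := fun=> 0) (nsa_closed nA) Mu _ uy).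
  by rewrite /form_cvg subr0 rip0l; exact: cvg_cst.
have [||m Mm hm] := riesz Mform (l := fun p => rip p x) (c := rip x x) Mcomp.
- by move=> t u v _ _; rewrite ripDl ripZl.
- by move=> u _; rewrite mulrC; exact: rip_CS.
by exists m => // m' Mm'; rewrite ripBl ![rip _ m']ripC hm// subrr.
Qed.

Lemma csubmod_dom A : csubmod A -> csubmod (lr_dom A).
Proof.
move=> [A0 AD]; split=> [|c u v [u' Au] [v' Av]]; first by exists 0.
by exists (c *: u' + v'); exact: (AD c _ _ Au Av).
Qed.

End Relations.

(** * Closed forms *)

Section ClosedForms.
Variables (R : realType) (H : hilbertSpace R).
Local Notation rel := (set (H * H)).
Implicit Types (D : set H) (q : H -> H -> R).

Definition graph_form q x y : R := q x y + rip x y.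

(** Invariance under [i] makes [q] the real part of a sesquilinear form; closedness is completeness
    in the graph norm. *)
Definition closed_form D q : Prop :=
  [/\ semidef_form D q,
      forall x y, D x -> D y -> q ('i%C *: x) ('i%C *: y) = q x y &
      form_complete D (graph_form q)].

(** The relation of the first representation theorem, given by its weak equation. Its multivalued
    part is the orthogonal complement of [D]. *)
Definition form_rel D q : rel :=
  [set p | D p.1 /\ forall f, D f -> q f p.1 = rip f p.2].

Lemma semidef_graph D q : semidef_form D q -> semidef_form D (graph_form q).
Proof.
move=> [Ds qs ql q0]; split=> // [x y Dx Dy|t x y z Dx Dy Dz|x Dx].
- by rewrite /graph_form qs// ripC.
- by rewrite /graph_form ql// ripDl ripZl; ring.
- by rewrite addr_ge0 ?q0 ?rip_ge0.
Qed.

Lemma closed_semidef D q : closed_form D q -> semidef_form D q.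
Proof. by case. Qed.

Lemma graph_form_ge0 D q x : closed_form D q -> D x -> 0 <= graph_form q x x.
Proof.
by move=> /closed_semidef/semidef_graph s; exact: (semidef_ge0 s).
Qed.

Section Theory.
Variables (D : set H) (q : H -> H -> R).
Hypothesis cDq : closed_form D q.
Let Dq : semidef_form D q. Proof. by case: cDq. Qed.
Let Ds : csubmod D. Proof. by case: Dq. Qed.
Let Dg := semidef_graph Dq.
Local Notation A := (form_rel D q).

Lemma closed_form_i x y : D x -> D y -> q x ('i%C *: y) = - q ('i%C *: x) y.
Proof.
case: cDq => _ qi _ Dx Dy; have Dix := csubmodZ 'i%C Ds Dx.
have Diy := csubmodZ 'i%C Ds Dy.
rewrite -qi// scalerA -expr2 sqr_i -(rmorphN1 (real_complex R)).
by rewrite (semidefZr Dq)// mulN1r.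
Qed.

Lemma form_rel_csubmod : csubmod A.
Proof.
have D0 : D 0 by case: Ds.
apply: csubmod_realI.
- split=> // f Df; rewrite rip0r (semidef_sym Dq)//; exact: (semidef0l Dq).
- move=> t x y [Dx qx] [Dy qy]; split=> [|f Df]; first by apply: csubmodD => //; exact: csubmodZ.
  rewrite /= ripDr ripZr -qx// -qy// (semidefDr Dq)//; last exact: csubmodZ.
  by rewrite (semidefZr Dq).
- move=> x [Dx qx]; split=> [|f Df] /=; first exact: csubmodZ.
  by rewrite closed_form_i// qx ?rip_ir//; exact: csubmodZ.
Qed.

(** The Riesz vector of [(., h)] for the graph form solves the weak equation. *)
Lemma form_rel_resolvent h : exists f, A (f, h - f).
Proof.
have [_ _ comp] := cDq.
have [||f Df hf] := riesz Dg (l := fun p => rip p h) (c := rip h h) comp.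
- by move=> t u v _ _; rewrite ripDl ripZl.
- move=> u Du; apply: le_trans (rip_CS u h) _; rewrite mulrC.
  by rewrite ler_wpM2l ?rip_ge0// lerDr (semidef_ge0 Dq).
exists f; split=> // g Dg' /=.
by rewrite ripBr -hf// /graph_form addrK.
Qed.

Lemma form_rel_nsa : nonneg_selfadjoint A.
Proof.
apply: nsa_intro; [exact: form_rel_csubmod| | |exact: form_rel_resolvent].
- move=> x y [Dx qx] [Dy qy]; rewrite -qy// ripC -qx//; exact: (semidef_sym Dq).
- by move=> x [Dx qx]; rewrite ripC -qx//; exact: (semidef_ge0 Dq).
Qed.

(* [rip f (f + f')] is [((A + 1)^-1 h, h)] for [h = f + f']. *)
Lemma form_rel_le f f' x : A (f, f') -> D x ->
  rip (f + f') x ^+ 2 <= graph_form q x x * rip f (f + f').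
Proof.
move=> [/= Df qf] Dx.
have -> : rip (f + f') x = graph_form q x f.
  by rewrite /graph_form qf// ripDl ![rip _ x]ripC addrC.
have -> : rip f (f + f') = graph_form q f f.
  by rewrite /graph_form qf// ripDr addrC.
exact: (semidef_CS Dg).
Qed.

(* By [riesz_sequence] there are [h_n] with [R h_n] Cauchy in form norm and
   [(R h, h_n)] tending to [(h, x)], so that [R h_n] tends to [x]. *)
Lemma form_rel_domP (c : R) x : 0 <= c ->
  (forall f f', A (f, f') -> rip (f + f') x ^+ 2 <= c * rip f (f + f')) ->
  D x /\ graph_form q x x <= c.
Proof.
move=> c0 hc; have As := form_rel_csubmod.
(* With [h] and [k] the sums of the components of [p] and [r], this is [(R h, k)]. *)
pose a (p r : H * H) := rip p.1 (r.1 + r.2).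
have aE p r : A p -> A r -> a p r = graph_form q p.1 r.1.
  by move=> [Dp _] [_ qr]; rewrite /a ripDr -qr// addrC.
have aform : semidef_form A a.
  split=> // [p r Ap Ar|t u v z _ _ _|u Au].
  - rewrite !aE//; apply: (semidef_sym Dg); [by case: Ap|by case: Ar].
  - by rewrite /a fst_lin ripDl ripZl.
  - by rewrite aE//; apply: (semidef_ge0 Dg); case: Au.
have [||u [Au uc ul]] :=
    riesz_sequence aform (l := fun p => rip (p.1 + p.2) x) (c := c).
- by move=> t u v _ _; rewrite sum_lin (ripDl (_ *: _)) ripZl.
- by move=> p Ap; apply: hc; rewrite -surjective_pairing.
have Du n : D (u n).1 by case: (Au n).
have [_ _ comp] := cDq.
have [e /uc[N hN]|y Dy uy] := comp _ Du.
  exists N => m n Nm Nn; have := hN m n Nm Nn.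
  by rewrite aE//; exact: csubmodB.
have ury : form_cvg rip (fun n => (u n).1) y.
  apply: (cvg0_le _ uy) => n; rewrite rip_ge0 /= lerDr (semidef_ge0 Dq)//.
  exact: csubmodB.
have xy : x = y.
  apply/eqP; rewrite -subr_eq0; apply/eqP/rip_perp => h.
  have [f Af] := form_rel_resolvent h.
  have := form_cvg_pair (rip_semidef (@csubmodT R H)) (fun=> I) I (I : setT h) ury.
  have := ul _ Af; rewrite /= [f + _]addrC subrK => l1 l2.
  have l3 : (fun n => a (f, h - f) (u n)) = (fun n => rip h (u n).1).
    apply/funext => n; rewrite (semidef_sym aform)// /a /= [f + _]addrC subrK.
    exact: ripC.
  rewrite l3 in l1.
  by rewrite ripBr (cvg_unique _ l1 l2) ?subrr.
rewrite xy; split=> //.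
have gy : (fun n => graph_form q (u n).1 (u n).1) @ \oo --> graph_form q y y.
  exact: (form_cvg_sqr Dg).
have gy2 : (fun n => graph_form q y (u n).1) @ \oo --> graph_form q y y.
  exact: (form_cvg_pair Dg).
(* The limit of the hypothesis taken at [u n]. Dividing by [graph_form q y y] gives the bound,
   except when that value is zero, where [c0] is used. *)
have le2 : graph_form q y y * graph_form q y y <= c * graph_form q y y.
  apply: (@ler_cvg_to _ \oo _ _
      (fun n => graph_form q y (u n).1 * graph_form q y (u n).1)
      (fun n => c * graph_form q (u n).1 (u n).1)); [exact: cvgM|exact: cvgMr|].
  apply: nearW => n /=.
  have := hc _ _ (_ : A ((u n).1, (u n).2)).
  rewrite -surjective_pairing => /(_ (Au n)).
  rewrite -[rip (u n).1 _]/(a (u n) (u n)) aE// -expr2 xy.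
  suff -> : graph_form q y (u n).1 = rip ((u n).1 + (u n).2) y by [].
  have [_ qu] := Au n; rewrite /graph_form qu// ripDl ![rip _ y]ripC.
  by rewrite addrC.
have := semidef_ge0 Dg Dy; rewrite le_eqVlt => /orP[/eqP g0|g0]; last first.
  by move: le2; rewrite ler_pM2r.
by rewrite -g0.
Qed.

End Theory.
End ClosedForms.

(** * Order and uniqueness of closed forms through resolvents *)

Section FormComparison.
Variables (R : realType) (H : hilbertSpace R).
Implicit Types (D : set H) (q : H -> H -> R).

Definition form_le D1 q1 D2 q2 := forall x : H,
  D2 x -> D1 x /\ q1 x x <= q2 x x :> R.

(** [rip f2 h] is the second graph form at [f2], which bounds the first one there; [form_rel_le]
    then gives [(f2, h)^2 <= (f2, h) (f1, h)]. *)
Lemma form_le_resolvent D1 q1 D2 q2 f1 f2 h :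
  closed_form D1 q1 -> closed_form D2 q2 -> form_le D1 q1 D2 q2 ->
  form_rel D1 q1 (f1, h - f1) -> form_rel D2 q2 (f2, h - f2) ->
  rip f2 h <= rip f1 h.
Proof.
move=> c1 c2 le12 r1 r2; have [/= Df2 qf2] := r2.
have [Df1 le2] := le12 _ Df2.
have := form_rel_le c1 r1 Df1; rewrite [f1 + _]addrC subrK => h1.
have e2 : graph_form q2 f2 f2 = rip f2 h.
  by rewrite /graph_form qf2// ripBr subrK.
have le3 : graph_form q1 f2 f2 <= rip f2 h by rewrite -e2 lerD2r.
have g1 : 0 <= rip f1 h.
  have [/= Dg qg] := r1; have -> : rip f1 h = graph_form q1 f1 f1.
    by rewrite /graph_form qg// ripBr subrK.
  exact: graph_form_ge0 c1 Dg.
have g2 : 0 <= rip f2 h.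
  by rewrite -e2; exact: graph_form_ge0 c2 Df2.
have le4 := le_trans h1 (ler_wpM2r g1 le3).
rewrite [rip h _]ripC expr2 in le4; move: g2.
rewrite le_eqVlt => /orP[/eqP <- //|g2].
by move: le4; rewrite ler_pM2l.
Qed.

(** The inequality that [x] satisfies for the second resolvent passes to the larger first one, and
    [form_rel_domP] reads off domain and value. *)
Lemma form_le_of_resolvent D1 q1 D2 q2 :
  closed_form D1 q1 -> closed_form D2 q2 ->
  (forall f1 f2 h, form_rel D1 q1 (f1, h - f1) ->
     form_rel D2 q2 (f2, h - f2) -> rip f2 h <= rip f1 h) ->
  form_le D1 q1 D2 q2.
Proof.
move=> c1 c2 hle x D2x.
have g0 : 0 <= graph_form q2 x x by exact: graph_form_ge0 c2 D2x.
have [||] := @form_rel_domP _ _ D1 q1 c1 (graph_form q2 x x) x => //.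
  move=> f f' Af; have [g Ag] := form_rel_resolvent c2 (f + f').
  apply: le_trans (_ : graph_form q2 x x * rip g (f + f') <= _).
    have := form_rel_le c2 Ag D2x.
    by rewrite [g + _]addrC subrK.
  by rewrite ler_wpM2l//; apply: (hle _ _ _ _ Ag); rewrite addrC addKr.
by move=> D1x; rewrite /graph_form lerD2r.
Qed.

Lemma form_le_uniq D1 q1 D2 q2 : closed_form D1 q1 -> closed_form D2 q2 ->
  form_rel D1 q1 `<=` form_rel D2 q2 -> form_le D1 q1 D2 q2.
Proof.
move=> c1 c2 sub; apply: form_le_of_resolvent => // f1 f2 h r1 r2.
have r1' := sub _ r1.
(* Both elements now lie in the second relation, so [q2] is compared with itself. *)
by apply: (form_le_resolvent c2 c2 _ r1' r2) => x Dx.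
Qed.

Lemma form_polar D1 q1 D2 q2 : semidef_form D1 q1 -> semidef_form D2 q2 ->
  D1 = D2 -> (forall x, D1 x -> q1 x x = q2 x x) ->
  forall x y, D1 x -> D1 y -> q1 x y = q2 x y.
Proof.
move=> s1 s2 D12 q12 x y Dx Dy; have [Ds _ _ _] := s1.
have := q12 _ (csubmodB Ds Dx Dy).
have := (Dx, Dy); rewrite {1 2}D12 => -[Dx2 Dy2].
by rewrite (semidefB_sqr s1)// (semidefB_sqr s2)// !q12//; lra.
Qed.

Lemma form_rel_ext D1 q1 D2 q2 : D1 = D2 ->
  (forall x y, D1 x -> D1 y -> q1 x y = q2 x y) ->
  form_rel D1 q1 = form_rel D2 q2.
Proof.
move=> <- q12; apply/seteqP; split=> p [Dp qp]; split=> // f Df.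
  by rewrite -q12// qp.
by rewrite q12// qp.
Qed.

Lemma form_rel_inj D1 q1 D2 q2 : closed_form D1 q1 -> closed_form D2 q2 ->
  form_rel D1 q1 = form_rel D2 q2 ->
  D1 = D2 /\ forall x y, D1 x -> D1 y -> q1 x y = q2 x y.
Proof.
move=> c1 c2 e12.
have le12 : form_le D1 q1 D2 q2 by apply: form_le_uniq => //; rewrite e12.
have le21 : form_le D2 q2 D1 q1 by apply: form_le_uniq => //; rewrite e12.
have D12 : D1 = D2.
  by apply/seteqP; split=> x Dx; [case: (le21 _ Dx)|case: (le12 _ Dx)].
split=> //; apply: (form_polar (closed_semidef c1) (closed_semidef c2)) => // x Dx.
have [D2x h1] := le21 _ Dx; have [_ h2] := le12 _ D2x.
by apply/eqP; rewrite eq_le h1 h2.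
Qed.

End FormComparison.

(** * Square roots *)

Section BoundedSquareRoots.
Variables (R : realType) (H : hilbertSpace R).
Implicit Types (x y z : H) (Z P T B Y C : H -> H).

(* [0 <= Z <= 1], expressed as [Z^2 <= Z]; linearity follows from symmetry. *)
Definition effect Z := (forall x y, rip (Z x) y = rip x (Z y)) /\
  forall x, rip (Z x) (Z x) <= rip (Z x) x.

(** Linearity is over the reals; complex linearity of a root will come from its commuting with
    multiplication by [i], itself such a map. *)
Definition real_contraction C :=
  (forall (t : R) x y, C (t%:C *: x + y) = t%:C *: C x + C y) /\
  forall x, rip (C x) (C x) <= rip x x.

Lemma effect_contraction Z : effect Z -> real_contraction Z.
Proof.
move=> [Zs Zle]; split=> [t x y|x].
  apply/eqP; rewrite -subr_eq0; apply/eqP/rip_perp => z.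
  by rewrite ripBr -Zs !(ripDr, ripZr) !Zs; ring.
have := rip_ge0 (x - Z x); have := Zle x.
by rewrite !(ripBl, ripBr) [rip x (Z x)]ripC; lra.
Qed.

Lemma contractionB C x y : real_contraction C -> C (x - y) = C x - C y.
Proof.
move=> [Cl _]; have := Cl (-1) y x.
by rewrite (rmorphN1 (real_complex R)) !scaleN1r addrC => ->; rewrite addrC.
Qed.

Lemma contraction0 C : real_contraction C -> C 0 = 0.
Proof. by move=> Cc; have := contractionB 0 0 Cc; rewrite !subrr. Qed.

Lemma contractionD C x y : real_contraction C -> C (x + y) = C x + C y.
Proof.
by move=> [Cl _]; have := Cl 1 x y; rewrite !scale1r.
Qed.

Lemma contractionZ C (t : R) x : real_contraction C ->
  C (t%:C *: x) = t%:C *: C x.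
Proof.
by move=> Cc; have [Cl _] := Cc; have := Cl t x 0; rewrite (contraction0 Cc) !addr0.
Qed.

Lemma effect_ge0 Z x : effect Z -> 0 <= rip (Z x) x.
Proof. by move=> [_ Zle]; exact: le_trans (rip_ge0 _) (Zle x). Qed.

Lemma effect_compl Z : effect Z -> effect (fun x => x - Z x).
Proof.
move=> [Zs Zle]; split=> [x y|x]; first by rewrite ripBl ripBr Zs.
by have := Zle x; rewrite !(ripBl, ripBr) [rip x (Z x)]ripC; lra.
Qed.

Lemma contraction_i : real_contraction (fun x => 'i%C *: x).
Proof.
split=> [t x y|x]; last by rewrite rip_ii.
by rewrite scalerDr !scalerA mulrC.
Qed.

(** The triangle inequality in squared form; [c] will be the squared norm of a fixed vector. *)
Lemma rip_triangle (a b c : R) x y : 0 <= a -> 0 <= b -> 0 <= c ->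
  rip x x <= a ^+ 2 * c -> rip y y <= b ^+ 2 * c ->
  rip (x + y) (x + y) <= (a + b) ^+ 2 * c.
Proof.
move=> a0 b0 c0 hx hy.
have : rip x y <= a * b * c.
  apply: sqr_le_le; first by rewrite !mulr_ge0.
  apply: le_trans (rip_CS x y) _.
  rewrite (_ : (a * b * c) ^+ 2 = (a ^+ 2 * c) * (b ^+ 2 * c)); last by ring.
  by rewrite ler_pM// rip_ge0.
by rewrite !(ripDl, ripDr) [rip y x]ripC; lra.
Qed.

Lemma form_cvg_le (u v : nat -> H) x y (c : R) :
  (forall n, rip (v n - y) (v n - y) <= c * rip (u n - x) (u n - x)) ->
  form_cvg rip u x -> form_cvg rip v y.
Proof.
move=> h ux; apply: (@cvg0_le _ _ (fun n => c * rip (u n - x) (u n - x))).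
  by move=> n; rewrite rip_ge0 h.
by rewrite -[X in _ --> X](mulr0 c); exact: cvgMr.
Qed.

Section Iteration.
Variable B : H -> H.
Hypothesis Be : effect B.

Let Bc := effect_contraction Be.

(* A fixed point of [Y = (B + Y^2) / 2] makes [1 - Y] a square root of [1 - B].
   The scalar iteration with [B = 1] dominates the differences of the iterates. *)
Definition sqrt_iter n : H -> H :=
  iter n (fun Y x => (2^-1)%:C *: (B x + Y (Y x))) (fun=> 0).

Definition sqrt_majorant n : R := iter n (fun t => (1 + t ^+ 2) / 2) 0.

Local Notation Y := sqrt_iter.
Local Notation y := sqrt_majorant.

Lemma sqrt_iter_effect n : effect (Y n).
Proof.
elim: n => [|n [Ys Yle]]; first by split=> *; rewrite ?rip0l ?rip0r.
have Ye : effect (Y n) by [].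
case: Be => Bs Ble; rewrite /sqrt_iter iterS -/(Y n); split=> [u v|u].
  by rewrite ripZl ripZr ripDl ripDr Bs !Ys.
(* The square of the half sum is at most half the sum of squares; here [|B u|^2 <= (B u, u)] and
   [|Y Y u|^2 <= |Y u|^2 = (Y Y u, u)]. *)
have [_ Yc] := effect_contraction Ye; have := Yc (Y n u).
have := ripD_sqr_le (B u) (Y n (Y n u)); have := Ble u; have := Ys (Y n u) u.
rewrite !ripZl ripZr; move: (Y n (Y n u)) => v.
by rewrite [rip (B u + v) u]ripDl; lra.
Qed.

Lemma sqrt_majorant_bounds n : 0 <= y n <= 1.
Proof.
elim: n => [|n]; first by rewrite lexx ler01.
by rewrite /sqrt_majorant iterS -/(y n) => /andP[y0 y1]; apply/andP; split; nra.
Qed.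

Lemma sqrt_majorantS n : y n.+1 = (1 + y n ^+ 2) / 2.
Proof. by []. Qed.

Lemma sqrt_iterS n x : Y n.+1 x = (2^-1)%:C *: (B x + Y n (Y n x)).
Proof. by []. Qed.

Lemma sqrt_majorant_nd : nondecreasing_seq y.
Proof.
apply/nondecreasing_seqP => n; rewrite sqrt_majorantS.
have := sqr_ge0 (1 - y n); lra.
Qed.

Lemma sqrt_iter_le n x : rip (Y n x) (Y n x) <= y n ^+ 2 * rip x x.
Proof.
elim: n x => [|n IH] x; first by rewrite rip0l expr0n mul0r.
rewrite sqrt_iterS ripZl ripZr; have [_ Bx] := Bc.
have /andP[y0 y1] := sqrt_majorant_bounds n.
have h1 : rip (Y n (Y n x)) (Y n (Y n x)) <= (y n ^+ 2) ^+ 2 * rip x x.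
  apply: le_trans (IH _) _.
  have -> c : (y n ^+ 2) ^+ 2 * c = y n ^+ 2 * (y n ^+ 2 * c) by ring.
  by rewrite ler_wpM2l ?sqr_ge0.
have h2 : rip (B x) (B x) <= 1 ^+ 2 * rip x x by rewrite expr1n mul1r.
have := rip_triangle ler01 (sqr_ge0 (y n)) (rip_ge0 x) h2 h1.
by rewrite sqrt_majorantS; lra.
Qed.

Let sqrM_assoc (a b c : R) : (a * b) ^+ 2 * c = a ^+ 2 * (b ^+ 2 * c).
Proof. by ring. Qed.

(** The splitting [Y_n^2 - Y_m^2 = Y_n (Y_n - Y_m) + (Y_n - Y_m) Y_m] is bounded factor by factor,
    and the bounds add up to [y_n^2 - y_m^2], twice the next difference of the majorant. *)
Lemma sqrt_iter_diff m k x :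
  rip (Y (m + k) x - Y m x) (Y (m + k) x - Y m x) <=
  (y (m + k) - y m) ^+ 2 * rip x x.
Proof.
elim: m x => [|m IH] x; first by rewrite add0n !subr0; exact: sqrt_iter_le.
set n := (m + k)%N in IH *; rewrite addSn -/n.
have Yc := effect_contraction (sqrt_iter_effect n).
have -> : Y n.+1 x - Y m.+1 x = (2^-1)%:C *:
    (Y n (Y n x - Y m x) + (Y n (Y m x) - Y m (Y m x))).
  rewrite !sqrt_iterS -scalerBr (contractionB _ _ Yc); congr (_ *: _).
  by rewrite subrKA opprD addrACA subrr add0r.
rewrite ripZl ripZr.
have /andP[yn0 yn1] := sqrt_majorant_bounds n.
have /andP[ym0 ym1] := sqrt_majorant_bounds m.
have d0 : 0 <= y n - y m by rewrite subr_ge0 sqrt_majorant_nd// leq_addr.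
have h1 : rip (Y n (Y n x - Y m x)) (Y n (Y n x - Y m x)) <=
    (y n * (y n - y m)) ^+ 2 * rip x x.
  apply: le_trans (sqrt_iter_le _ _) _; rewrite sqrM_assoc.
  by rewrite ler_wpM2l ?sqr_ge0.
have h2 : rip (Y n (Y m x) - Y m (Y m x)) (Y n (Y m x) - Y m (Y m x)) <=
    ((y n - y m) * y m) ^+ 2 * rip x x.
  apply: le_trans (IH _) _; rewrite sqrM_assoc.
  by rewrite ler_wpM2l ?sqr_ge0// sqrt_iter_le.
have := rip_triangle (mulr_ge0 yn0 d0) (mulr_ge0 d0 ym0) (rip_ge0 x) h1 h2.
by rewrite !sqrt_majorantS; lra.
Qed.

Lemma sqrt_iter_cauchy x : form_cauchy rip (fun n => Y n x).
Proof.
move=> e e0; have yc : cvgn y.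
  apply: nondecreasing_is_cvgn; first exact: sqrt_majorant_nd.
  by exists 1 => _ [n _ <-]; case/andP: (sqrt_majorant_bounds n).
(* For [0 <= s <= d], the bound [d <= 1] gives [s ^+ 2 <= d], and the other bound then gives
   [s ^+ 2 * rip x x <= e]. *)
pose d := Num.min 1 (e / (1 + rip x x)).
have x1 : 0 < 1 + rip x x by have := rip_ge0 x; lra.
have d0 : 0 < d by rewrite lt_min ltr01 divr_gt0.
have /cvgrPdist_le/(_ _ d0)[N _ hN] := yc; exists N.
suff main m k : (N <= m)%N ->
    rip (Y (m + k) x - Y m x) (Y (m + k) x - Y m x) <= e.
  move=> m n Nm Nn; have [/subnKC <-|/ltnW/subnKC <-] := leqP n m.
    exact: main.
  by rewrite -opprB ripNl ripNr opprK; exact: main.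
move=> Nm; apply: le_trans (sqrt_iter_diff _ _ _) _.
have /= := hN m Nm; have yn := nondecreasing_cvgn_le sqrt_majorant_nd yc.
have hm := yn m; have hmk := yn (m + k)%N.
have hd : y m <= y (m + k)%N by rewrite sqrt_majorant_nd// leq_addr.
rewrite ger0_norm ?subr_ge0// => hl.
have d1 : d <= 1 by rewrite ge_min lexx.
have d2 : d * (1 + rip x x) <= e by rewrite -ler_pdivlMr// ge_min lexx orbT.
have s0 : 0 <= y (m + k)%N - y m by rewrite subr_ge0.
have s1 : y (m + k)%N - y m <= d by lra.
move: (y (m + k)%N - y m) s0 s1 => s s0 s1.
have sd : s ^+ 2 <= d by nra.
have := rip_ge0 x; nra.
Qed.

End Iteration.

(** [T = 1 - Y], where [Y] is the strong limit of the iterates for [B = 1 - P]. A contraction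
    commuting with [P] commutes with every iterate, hence with the limit. *)
Lemma effect_sqrt P : effect P -> exists T, [/\ effect T,
  forall x, T (T x) = P x &
  forall C, real_contraction C -> (forall x, P (C x) = C (P x)) ->
    forall x, T (C x) = C (T x)].
Proof.
move=> Pe; have Be := effect_compl Pe; set B := fun x => x - P x in Be.
pose Yn := sqrt_iter B.
have Yne n : effect (Yn n) := sqrt_iter_effect Be n.
have Ync n := effect_contraction (Yne n).
have /choice[Y hY] x : exists z, form_cvg rip (fun n => Yn n x) z.
  exact: rip_complete (sqrt_iter_cauchy Be x).
have Yp x z : (fun n => rip z (Yn n x)) @ \oo --> rip z (Y x).
  exact: (form_cvg_pair (rip_semidef (@csubmodT R H)) (fun=> I) I I (hY x)).
have Ye : effect Y.
  split=> [x z|x].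
    rewrite ripC; apply: (cvg_unique _ (Yp x z)) => //.
    rewrite (_ : (fun n => _) = (fun n => rip x (Yn n z))); first exact: Yp.
    by apply/funext => n; case: (Yne n) => Ys _; rewrite -Ys ripC.
  rewrite [rip _ x]ripC; apply: (@ler_cvg_to _ \oo _ _
    (fun n => rip (Yn n x) (Yn n x)) (fun n => rip x (Yn n x))).
  - exact: (form_cvg_sqr (rip_semidef (@csubmodT R H)) (fun=> I) I (hY x)).
  - exact: Yp.
  - by apply: nearW => n; case: (Yne n) => _; rewrite [rip x _]ripC; exact.
have Yfix x : Y x = (2^-1)%:C *: (B x + Y (Y x)).
  (* Inserting [Yn n (Y x)] leaves two differences: the first is controlled by contractivity of
     [Yn n], the second by convergence at [Y x]. *)
  have YY : form_cvg rip (fun n => Yn n (Yn n x)) (Y (Y x)).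
    apply: (@cvg0_le _ _ (fun n => 2 * rip (Yn n x - Y x) (Yn n x - Y x) +
      2 * rip (Yn n (Y x) - Y (Y x)) (Yn n (Y x) - Y (Y x)))).
      move=> n; rewrite rip_ge0 /=.
      rewrite -(subrKA (Yn n (Y x))) -contractionB//.
      apply: le_trans (ripD_sqr_le _ _) _; rewrite lerD2r ler_wpM2l//.
      by case: (Ync n).
    rewrite [X in _ --> X](_ : 0 = 2 * 0 + 2 * 0); last by ring.
    by apply: cvgD; apply: cvgMr; exact: hY.
  apply: (@form_cvg_uniq _ _ (fun n => Yn n.+1 x)).
    by have := hY x; rewrite /form_cvg -(cvg_shiftS (fun n => rip (Yn n x - Y x) _)).
  apply: (form_cvg_le (c := 1) _ YY) => n; rewrite mul1r.
  rewrite /Yn sqrt_iterS -scalerBr opprD addrACA subrr add0r ripZl ripZr -/Yn.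
  by have := rip_ge0 (Yn n (Yn n x) - Y (Y x)); lra.
have Yc := effect_contraction Ye.
exists (fun x => x - Y x); split.
- exact: effect_compl.
- move=> x; rewrite contractionB//.
  have : Y x + Y x = B x + Y (Y x).
    by rewrite {1 2}Yfix -scalerDl -rmorphD (_ : 2^-1 + 2^-1 = 1 :> R) ?scale1r//; field.
  move=> YB; apply: rip_ext => z; have := congr1 (rip z) YB.
  by rewrite /B !(ripBr, ripDr); lra.
- move=> C Cc PC x; rewrite contractionB//; congr (_ - _).
  have YnC n z : Yn n (C z) = C (Yn n z).
    elim: n z => [|n IH] z; first by rewrite /= contraction0.
    by rewrite /Yn !sqrt_iterS -/Yn !IH (contractionZ _ _ Cc) (contractionD _ _ Cc)
      /B PC (contractionB _ _ Cc).
  apply: (form_cvg_uniq (hY (C x))).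
  apply: (form_cvg_le (c := 1) _ (hY x)) => n; rewrite mul1r YnC.
  by rewrite -contractionB//; case: Cc.
Qed.

End BoundedSquareRoots.

(** * Square root of the operator part of a relation *)

Section SquareRoot.
Variables (R : realType) (H : hilbertSpace R).
Local Notation rel := (set (H * H)).
Implicit Types (A S : rel) (K : set H).

Lemma csubmod_perp (K : set H) : csubmod K ->
  csubmod [set f | forall m, K m -> rip f m = 0].
Proof.
move=> Ks; apply: csubmod_realI => [m _|t x y hx hy m Km|x hx m Km].
- by rewrite rip0l.
- by rewrite ripDl ripZl hx// hy// mulr0 addr0.
- by apply/eqP; rewrite -oppr_eq0 -rip_ir hx//; exact: csubmodZ.
Qed.

(* With T and W the square roots of the resolvent and of its complement, the
   root of the operator part is [{T h, W h}], [h] orthogonal to [mul A]. *)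
Lemma lr_op_sqrt_ex A : nonneg_selfadjoint A -> exists S,
  nonneg_selfadjoint_op_in (ortho_compl (lr_mul A)) S /\
  lr_comp S S = lr_op A.
Proof.
move=> nA; have As := nsa_csubmod nA; have Ms := csubmod_mul As.
have /choice[P hP] h : exists f, A (f, h - f) by exact: nsa_resolvent.
have AP f f' : A (f, f') -> f = P (f + f').
  move=> Af; have Ad := csubmodB As Af (hP (f + f')).
  have d0 : f - P (f + f') = 0.
    apply: rip_le0; have := nsa_ge0 nA Ad => /=.
    by rewrite !(ripBl, ripBr, ripDl, ripDr); lra.
  by apply/eqP; rewrite -subr_eq0 d0.
have Pe : effect P.
  split=> [x y|x].
    have := nsa_sym nA (hP x) (hP y) => /=.
    by rewrite ripBl ripBr; lra.
  by have := nsa_ge0 nA (hP x); rewrite /= ripBl [rip x _]ripC; lra.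
have [T [Te TT Tcomm]] := effect_sqrt Pe.
have [W [We WW Wcomm]] := effect_sqrt (effect_compl Pe).
(* The fourth root of the resolvent serves for positivity: [(W h, T h) = (W V h, V h)]. *)
have [V [Ve VV Vcomm]] := effect_sqrt Te.
have [Tc Wc Vc] := And3 (effect_contraction Te) (effect_contraction We)
  (effect_contraction Ve).
have WT x : W (T x) = T (W x).
  by apply: Wcomm => // z; rewrite contractionB// -!TT.
have WV x : W (V x) = V (W x) by rewrite Vcomm// => z; rewrite WT.
have Ti x : T ('i%C *: x) = 'i%C *: T x.
  apply: Tcomm (@contraction_i R H) _ x => z; apply/esym.
  have := csubmodZ 'i%C As (hP z) => /AP; rewrite /= -scalerDr => ->.
  by rewrite addrC subrK.
have Wi x : W ('i%C *: x) = 'i%C *: W x.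
  apply: Wcomm (@contraction_i R H) _ x => z.
  by rewrite -!TT !Ti scalerBr.
pose K := [set f | forall m, lr_mul A m -> rip f m = 0].
have KE : ortho_compl (lr_mul A) = K by exact: ortho_complE.
have Ks : csubmod K by exact: csubmod_perp.
have [Tsym Tle] := Te; have [Wsym Wle] := We; have [Vsym Vle] := Ve.
(* [mul A] is the kernel of the resolvent; there [T] vanishes and [W] is the identity. *)
have mulP m : lr_mul A m <-> P m = 0.
  split=> [/AP|Pm]; first by rewrite add0r.
  by have := hP m; rewrite Pm subr0.
have T0 m : lr_mul A m -> T m = 0.
  by move=> /mulP Pm; apply: rip_eq0; rewrite Tsym TT Pm rip0r.
have W1 m : lr_mul A m -> W m = m.
  move=> /mulP Pm; apply/eqP; rewrite -subr_eq0; apply/eqP/rip_le0.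
  have := effect_ge0 (W m - m) We.
  rewrite contractionB// WW Pm subr0 -opprB ripNl; lra.
have KT h : K (T h) by move=> m Mm; rewrite Tsym T0// rip0r.
have KW h : K h -> K (W h) by move=> Kh m Mm; rewrite Wsym W1// Kh.
pose S : rel := [set p | exists2 h, K h & p = (T h, W h)].
have Ss : csubmod S.
  apply: csubmod_realI.
  - by exists 0; [case: Ks|rewrite !contraction0].
  - move=> t _ _ [h Kh ->] [k Kk ->]; exists (t%:C *: h + k).
      by case: Ks => _; exact.
    by case: Tc => -> _; case: Wc => -> _.
  - move=> _ [h Kh ->]; exists ('i%C *: h); first exact: (csubmodZ 'i%C Ks Kh).
    by rewrite Ti Wi.
have Ssub : S `<=` rip_adj S.
  by move=> _ [h _ ->] _ [k _ ->] /=; rewrite Wsym WT Tsym.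
have Kperp x : K x -> (forall h, K h -> rip h x = 0) -> x = 0.
  by move=> Kx hx; apply: rip_eq0; exact: hx.
(* Since [T^2 + W^2 = 1] and the roots commute, a pair with [W h = T k] comes from the single vector
   [T h + W k]. *)
have inv h k : W h = T k -> T (T h + W k) = h /\ W (T h + W k) = k.
  move=> WhTk; split; rewrite contractionD//.
    by rewrite TT -WT -WhTk WW addrC subrK.
  by rewrite WT WhTk TT WW addrC subrK.
exists S; rewrite KE; split.
- have Sadj : lr_adj S `&` (K `*` K) = S.
    rewrite lr_adjE//; apply/seteqP; split=> [[g g'] [hg [/= Kg Kg']]|p Sp].
      (* Membership in the adjoint makes [W g - T g'] orthogonal to [K], while it lies in [K]; [inv]
         then exhibits [(g, g')] as an element of [S]. *)
      have d0 : W g - T g' = 0.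
        apply: Kperp; first exact: (csubmodB Ks (KW _ Kg) (KT _)).
        move=> h Kh; have := hg (T h, W h) => /(_ (ex_intro2 _ _ h Kh erefl)) /=.
        by rewrite Wsym Tsym ripBr => ->; rewrite subrr.
      have [h1 h2] : T (T g + W g') = g /\ W (T g + W g') = g'.
        by apply: inv; apply/eqP; rewrite -subr_eq0 d0.
      exists (T g + W g'); last by rewrite h1 h2.
      exact: (csubmodD Ks (KT _) (KW _ Kg')).
    split; first exact: Ssub.
    by case: Sp => h Kh ->; split => /=; [exact: KT|exact: KW].
  split=> //.
  + split; first exact/csubmodP.
    rewrite -Sadj lr_adjE//; apply: closedI; first exact: closed_rip_adj.
    (* Written as an adjoint, the product of the complements is closed. *)
    rewrite (_ : K `*` K = rip_adj [set p | lr_mul A p.1 /\ lr_mul A p.2]).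
      exact: closed_rip_adj.
    have [M0 _] := Ms.
    apply/seteqP; split=> [q [/= Kq1 Kq2] p [Mp1 Mp2]|q hq].
      by rewrite ripC [RHS]ripC Kq1// Kq2.
    split=> m Mm; rewrite ripC.
      by have := hq (0, m) (conj M0 Mm); rewrite /= rip0l.
    by have := hq (m, 0) (conj Mm M0); rewrite /= rip0l.
  + apply/lr_nonnegE => // _ [h _ ->] /=.
    by rewrite -VV -Vsym -WV effect_ge0.
  + apply/seteqP; split=> [x [h Kh [Th ->]]|_ ->].
      have -> : h = 0; last exact: contraction0.
      apply: rip_eq0; apply: Kh; apply/mulP.
      by rewrite -TT -Th contraction0.
    by exists 0; [case: Ks|rewrite !contraction0].
- rewrite /lr_op KE; apply/seteqP; split.
    move=> [f f'] [g /= [[h Kh [-> ->]] [k Kk [WhTk ->]]]].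
    have [h1 h2] := inv _ _ WhTk; split; last exact: KW.
    by have := hP (T h + W k); rewrite -WW -TT h1 h2.
  (* With [x = f + f'] the chain is [f = T (T x)], [W (T x) = T (W x)], [f' = W (W x)]. *)
  move=> [f f'] [/= Af Kf']; have fE := AP _ _ Af; pose x := f + f'.
  have Kx : K x by apply: (csubmodD Ks _ Kf'); rewrite fE -TT.
  exists (W (T x)) => /=; split.
    by exists (T x) => //; rewrite TT /x -fE.
  by exists (W x); [exact: KW|rewrite WT WW /x -fE [f + f']addrC addrK].
Qed.

End SquareRoot.

(** * Correspondence between relations and closed forms *)

Section RelationForms.
Variables (R : realType) (H : hilbertSpace R).
Local Notation rel := (set (H * H)).
Implicit Types (A B S : rel) (D : set H) (q : H -> H -> R).

(** * The form of a selfadjoint root [S], with [s] its values orthogonal to [mul S] *)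

Section FormOfRoot.
Variables (S : rel) (s : H -> H).
Hypothesis nS : nonneg_selfadjoint S.
Hypothesis Ss : forall x, lr_dom S x ->
  S (x, s x) /\ forall m, lr_mul S m -> rip (s x) m = 0.

Let Slin : csubmod S := nsa_csubmod nS.

Lemma root_uniq x y : S (x, y) -> (forall m, lr_mul S m -> rip y m = 0) ->
  s x = y.
Proof.
move=> Sxy ym; have [Sx xm] := Ss (ex_intro _ y Sxy).
have := csubmodB Slin Sx Sxy.
rewrite (_ : (x, s x) - (x, y) = (0, s x - y)); last by congr pair; exact: subrr.
move=> Md; apply/eqP; rewrite -subr_eq0; apply/eqP/rip_eq0.
by rewrite {1}ripBl xm// ym// subrr.
Qed.

Lemma root_lin c x y : lr_dom S x -> lr_dom S y ->
  s (c *: x + y) = c *: s x + s y.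
Proof.
move=> /Ss[Sx xm] /Ss[Sy ym]; apply: root_uniq.
  by have [_ h] := Slin; exact: (h c _ _ Sx Sy).
by have [_ h] := csubmod_perp (csubmod_mul Slin); exact: h.
Qed.

(** A sequence Cauchy in the graph form converges together with its images under [s]. As [S] is
    closed and the images stay orthogonal to [lr_mul S], their limit is the value of [s] at the
    limit. *)
Lemma root_closed_form : closed_form (lr_dom S) (fun x y => rip (s x) (s y)).
Proof.
have Ds := csubmod_dom Slin; have [D0 _] := Ds.
split.
- split=> // [x y _ _|t x y z Dx Dy _|x _]; first exact: ripC.
    by rewrite root_lin// ripDl ripZl.
  exact: rip_ge0.
- have s0 : s 0 = 0.
    by apply: root_uniq => [|m _]; [case: Slin|rewrite rip0l].
  have si x : lr_dom S x -> s ('i%C *: x) = 'i%C *: s x.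
    by move=> Dx; rewrite -[_ *: x]addr0 root_lin// s0 addr0.
  by move=> x y Dx Dy; rewrite !si// rip_ii.
- move=> u Du uc.
  have sB x y : lr_dom S x -> lr_dom S y -> s (x - y) = s x - s y.
    by move=> Dx Dy; rewrite addrC -scaleN1r root_lin// scaleN1r addrC.
  have [|x ux] := rip_complete (u := u).
    move=> e /uc[N hN]; exists N => m n Nm Nn; apply: le_trans (hN m n Nm Nn).
    by rewrite /graph_form lerDr rip_ge0.
  have [|y uy] := rip_complete (u := fun n => s (u n)).
    move=> e /uc[N hN]; exists N => m n Nm Nn; apply: le_trans (hN m n Nm Nn).
    by rewrite -sB// /graph_form lerDl rip_ge0.
  have Sxy : S (x, y).
    by apply: (closed_prod_seq (nsa_closed nS) _ ux uy) => n; case: (Ss (Du n)).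
  have Dx : lr_dom S x by exists y.
  exists x => //.
  have sx : s x = y.
    apply: root_uniq => // m Mm; rewrite ripC.
    have := form_cvg_pair (rip_semidef (@csubmodT R H)) (fun=> I) I (I : setT m) uy.
    have -> : (fun n => rip m (s (u n))) = (fun=> 0).
      by apply/funext => n; rewrite ripC; case: (Ss (Du n)) => _; exact.
    by move=> h; apply: (cvg_unique _ h (cvg_cst 0)).
  rewrite /form_cvg (_ : (fun n => _) = fun n =>
    rip (s (u n) - y) (s (u n) - y) + rip (u n - x) (u n - x)).
    by rewrite -[X in _ --> X](addr0 0); exact: cvgD.
  by apply/funext => n; rewrite /graph_form sB// sx.
Qed.

Lemma root_form_rel A : nonneg_selfadjoint A -> lr_comp S S = A ->
  form_rel (lr_dom S) (fun x y => rip (s x) (s y)) = A.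
Proof.
move=> nA SSA; have cS := root_closed_form.
have sub : A `<=` form_rel (lr_dom S) (fun x y => rip (s x) (s y)).
  rewrite -SSA => -[f f'] [g [Sfg Sgf]]; split; first by exists g.
  move=> x /Ss[Sx xm] /=.
  (* [g] lies in the domain of [S], which by symmetry is orthogonal to [lr_mul S]. *)
  have -> : s f = g.
    apply: root_uniq => // m Mm.
    by have := nsa_sym nS Sgf Mm; rewrite /= rip0r => <-.
  by have := nsa_sym nS Sx Sgf.
(* Maximality: a symmetric extension of [A] is contained in the adjoint of [A], that is in [A]. *)
apply/seteqP; split=> // p Fp; apply: nsa_adj => // r Ar.
exact: (nsa_sym (form_rel_nsa cS) (sub _ Ar) Fp).
Qed.

End FormOfRoot.

Lemma lr_op_sqrtP A : nonneg_selfadjoint A ->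
  nonneg_selfadjoint_op_in (ortho_compl (lr_mul A)) (lr_op_sqrt A) /\
  lr_comp (lr_op_sqrt A) (lr_op_sqrt A) = lr_op A.
Proof. by move=> nA; exact: (xgetPex _ (lr_op_sqrt_ex nA)). Qed.

Lemma lr_op_sqrt_app A x : form_dom A x ->
  lr_op_sqrt A (x, lr_app (lr_op_sqrt A) x).
Proof. exact: xgetPex. Qed.

Lemma lr_op_sqrt_perp A p : nonneg_selfadjoint A -> lr_op_sqrt A p ->
  forall m, lr_mul A m -> rip p.1 m = 0 /\ rip p.2 m = 0.
Proof.
move=> nA Sp m Mm; have [[_ <- _ _] _] := lr_op_sqrtP nA.
have [_ [/= h1 h2]] : (lr_adj (lr_op_sqrt A) `&`
    (ortho_compl (lr_mul A) `*` ortho_compl (lr_mul A))) p.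
  by have [[_ -> _ _] _] := lr_op_sqrtP nA.
by rewrite /rip h1// h2.
Qed.

Lemma lr_mul_sqrt A : nonneg_selfadjoint A -> lr_mul (lr_sqrt A) = lr_mul A.
Proof.
move=> nA; have [[[/csubmodP[S0 _] _] _ _ mS] _] := lr_op_sqrtP nA.
apply/seteqP; split=> [x [g [m [/= Sg Mm ->]]]|m Mm].
  have : lr_mul (lr_op_sqrt A) g by [].
  by rewrite mS => ->; rewrite add0r.
by exists 0, m; split=> //=; rewrite add0r.
Qed.

Lemma lr_dom_sqrt A : nonneg_selfadjoint A -> lr_dom (lr_sqrt A) = form_dom A.
Proof.
move=> nA; have [M0 _] := csubmod_mul (nsa_csubmod nA).
apply/seteqP; split=> [x [y [g [m [Sg _ _]]]]|x [g Sg]]; first by exists g.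
by exists g, g, 0; split=> //=; rewrite addr0.
Qed.

(** Restoring [mul A] turns the adjoint within its complement into the adjoint in [H]: an adjoint
    element has its first component orthogonal to [mul A], and its second is split by the projection
    onto [mul A]. *)
Lemma lr_sqrt_nsa A : nonneg_selfadjoint A -> nonneg_selfadjoint (lr_sqrt A).
Proof.
move=> nA; have As := nsa_csubmod nA; have Ms := csubmod_mul As.
have [[[/csubmodP Ss _] Sadj Snn mS] _] := lr_op_sqrtP nA.
have perp := lr_op_sqrt_perp nA.
set S := lr_op_sqrt A in Ss Sadj Snn mS perp *.
have [S0 SD] := Ss; have [M0 MD] := Ms.
have Ssub : S `<=` rip_adj S by rewrite -lr_adjE// -{1}Sadj => p [].
have {}Snn : rip_nonneg S by apply/lr_nonnegE.
apply/nonneg_selfadjointP; split.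
- split; first by exists 0, 0; split=> //=; rewrite addr0.
  move=> c x y [g [m [Sg Mm xE]]] [h [k [Sh Mk yE]]].
  exists (c *: g + h), (c *: m + k); split; [exact: (SD c _ _ Sg Sh)|exact: MD|].
  by rewrite snd_lin xE yE scalerDr addrACA.
- apply/seteqP; split=> [q hq|q [g [m [Sg Mm qE]]] p [h [k [Sh Mk pE]]]].
    have q1 m : lr_mul A m -> rip m q.1 = 0.
      move=> Mm; have := hq (0, m); rewrite /= rip0l; apply.
      by exists 0, m; split=> //=; rewrite add0r.
    have [m Mm mperp] := nsa_proj nA q.2.
    exists (q.2 - m), m; split=> //; last by rewrite subrK.
    change (S (q.1, q.2 - m)); rewrite -Sadj; split; last first.
      by rewrite !ortho_complE//; split=> /= k Mk; [rewrite ripC q1|exact: mperp].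
    rewrite lr_adjE// => p Sp /=; rewrite ripBr.
    have [-> _] := perp _ Sp m Mm; rewrite subr0.
    by apply: hq; exists p.2, 0; split=> //; rewrite -?surjective_pairing ?addr0.
  rewrite pE qE ripDl ripDr (Ssub _ Sg _ Sh) /= [rip k _]ripC.
  by have [-> _] := perp _ Sg k Mk; have [-> _] := perp _ Sh m Mm.
- move=> p [h [k [Sh Mk ->]]]; rewrite ripDl [rip k _]ripC.
  by have [-> _] := perp _ Sh k Mk; rewrite addr0; exact: (Snn _ Sh).
Qed.

Lemma lr_sqrt_comp A : nonneg_selfadjoint A ->
  lr_comp (lr_sqrt A) (lr_sqrt A) = A.
Proof.
move=> nA; have As := nsa_csubmod nA; have Ms := csubmod_mul As.
have [M0 _] := Ms; have [[_ _ _ _] SSE] := lr_op_sqrtP nA.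
have perp := lr_op_sqrt_perp nA.
set S := lr_op_sqrt A in SSE perp *.
apply/seteqP; split.
  move=> [f f'] [g [/= [h [m [/= Sh Mm gE]]] [k [n [/= Sk Mn ->]]]]].
  (* The intermediate vector [g] is in the domain of [S], hence orthogonal to [mul A], and so is
     [h]. *)
  have m0 : m = 0.
    apply: rip_eq0; have [+ _] := perp _ Sk m Mm.
    by rewrite gE /= ripDl; have [_ /= ->] := perp _ Sh m Mm; rewrite add0r.
  have [Afk _] : lr_op A (f, k).
    by rewrite -SSE; exists h; split=> //=; rewrite -(addr0 h) -m0 -gE.
  by have := csubmodD As Afk Mn; rewrite -[(f, k) + _]/(f + 0, k + n) addr0.
move=> [f f'] Af; have [m Mm mperp] := nsa_proj nA f'.
have : lr_op A (f, f' - m).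
  split; last by rewrite ortho_complE.
  by have := csubmodB As Af Mm; rewrite -[(f, f') - _]/(f - 0, f' - m) subr0.
rewrite -SSE => -[g [/= S1 S2]]; exists g; split=> /=.
  by exists g, 0; split=> //=; rewrite addr0.
by exists (f' - m), m; split=> //=; rewrite subrK.
Qed.

Definition rel_form A x y : R :=
  rip (lr_app (lr_op_sqrt A) x) (lr_app (lr_op_sqrt A) y).

Lemma lr_formE A x : lr_form A x = (rel_form A x x)%:C.
Proof. by rewrite /lr_form -ip_norm ip_self. Qed.

Lemma lr_sqrt_app A : nonneg_selfadjoint A ->
  forall x, lr_dom (lr_sqrt A) x -> lr_sqrt A (x, lr_app (lr_op_sqrt A) x) /\
    forall m, lr_mul (lr_sqrt A) m -> rip (lr_app (lr_op_sqrt A) x) m = 0.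
Proof.
move=> nA x; rewrite lr_dom_sqrt// lr_mul_sqrt// => /lr_op_sqrt_app Sx.
have [M0 _] := csubmod_mul (nsa_csubmod nA); split.
  by exists (lr_app (lr_op_sqrt A) x), 0; split=> //=; rewrite addr0.
by move=> m /(lr_op_sqrt_perp nA Sx)[].
Qed.

Lemma rel_form_closed A : nonneg_selfadjoint A ->
  closed_form (form_dom A) (rel_form A).
Proof.
move=> nA; rewrite -lr_dom_sqrt//.
exact: root_closed_form (lr_sqrt_nsa nA) (lr_sqrt_app nA).
Qed.

Lemma rel_formK A : nonneg_selfadjoint A ->
  form_rel (form_dom A) (rel_form A) = A.
Proof.
move=> nA; rewrite -lr_dom_sqrt//.
exact: (root_form_rel (lr_sqrt_nsa nA) (lr_sqrt_app nA) nA (lr_sqrt_comp nA)).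
Qed.

Lemma form_relK D q : closed_form D q ->
  form_dom (form_rel D q) = D /\
  forall x y, D x -> D y -> rel_form (form_rel D q) x y = q x y.
Proof.
move=> cq; have nF := form_rel_nsa cq.
have [h1 h2] := form_rel_inj (rel_form_closed nF) cq (rel_formK nF).
by split=> //; rewrite h1 in h2.
Qed.

(** Evaluates the choice in [lr_of_form]. Only quadratic values are prescribed there, so uniqueness
    goes through polarization. *)
Lemma lr_of_formE D q (Q : H -> R[i]) : closed_form D q ->
  (forall x, D x -> Q x = (q x x)%:C) -> lr_of_form D Q = form_rel D q.
Proof.
move=> cq Qq; have [d1 d2] := form_relK cq; apply: xget_unique.
  by split=> // [|x Dx]; [exact: form_rel_nsa|rewrite lr_formE d2// Qq].
move=> T [nT TD TQ]; rewrite -(rel_formK nT).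
apply: form_rel_ext => //.
apply: (form_polar (closed_semidef (rel_form_closed nT)) (closed_semidef cq)) => //.
move=> x; rewrite TD => Dx; have := TQ x Dx; rewrite lr_formE Qq// => h.
by have := congr1 (@complex.Re _) h.
Qed.

(* The inverse of a root of [A] is a root of [A^-1]. *)
Lemma lr_ran_sqrt A : nonneg_selfadjoint A ->
  lr_ran (lr_sqrt A) = form_dom (lr_inv A).
Proof.
move=> nA; have nS := nsa_inv (lr_sqrt_nsa nA).
set S := lr_inv (lr_sqrt A) in nS.
(* An image of [x] minus its projection onto [lr_mul S]; outside the domain the value 0 is a
   default. *)
have /choice[s hs] x : exists y, lr_dom S x ->
    S (x, y) /\ forall m, lr_mul S m -> rip y m = 0.
  have [[y Sy]|nx] := pselect (lr_dom S x); last by exists 0.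
  have [m Mm mperp] := nsa_proj nS y; exists (y - m) => _; split=> //.
  have := csubmodB (nsa_csubmod nS) Sy Mm.
  by rewrite -[(x, y) - _]/(x - 0, y - m) subr0.
have nI := nsa_inv nA.
have SSI : lr_comp S S = lr_inv A.
  rewrite -{1}(lr_sqrt_comp nA); apply/seteqP.
  by split=> p [g [h1 h2]]; exists g; split.
have := root_form_rel nS hs nI SSI; rewrite -{1}(rel_formK nI) => e.
by have [<-] := form_rel_inj (root_closed_form nS hs) (rel_form_closed nI) e.
Qed.

(** A sequence Cauchy for the sum is Cauchy for each form, and the two limits agree because both are
    limits in norm. *)
Lemma closed_formD D1 q1 D2 q2 : closed_form D1 q1 -> closed_form D2 q2 ->
  closed_form (D1 `&` D2) (fun x y => q1 x y + q2 x y).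
Proof.
move=> c1 c2; have [s1 i1 k1] := c1; have [s2 i2 k2] := c2.
have [d1 sy1 l1 g1] := s1; have [d2 sy2 l2 g2] := s2.
have d12 : csubmod (D1 `&` D2).
  split=> [|c x y [x1 x2] [y1 y2]]; first by case: d1; case: d2.
  by split; [case: d1 => _; exact|case: d2 => _; exact].
split.
- split=> // [x y [x1 x2] [y1 y2]|t x y z [x1 x2] [y1 y2] [z1 z2]|x [x1 x2]].
  + by rewrite sy1// sy2.
  + by rewrite l1// l2//; ring.
  + by rewrite addr_ge0 ?g1 ?g2.
- by move=> x y [x1 x2] [y1 y2]; rewrite i1// i2.
- move=> u Du uc.
  have Du1 n : D1 (u n) by case: (Du n).
  have Du2 n : D2 (u n) by case: (Du n).
  have [e /uc[N hN]|x Dx ux] := k1 u Du1.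
    exists N => m n Nm Nn; apply: le_trans (hN m n Nm Nn).
    by rewrite /graph_form lerD2r lerDl g2//; exact: csubmodB.
  have [e /uc[N hN]|y Dy uy] := k2 u Du2.
    exists N => m n Nm Nn; apply: le_trans (hN m n Nm Nn).
    by rewrite /graph_form lerD2r lerDr g1//; exact: csubmodB.
  have rx : form_cvg rip u x.
    apply: (cvg0_le _ ux) => n; rewrite rip_ge0 /= lerDr g1//.
    exact: csubmodB.
  have ry : form_cvg rip u y.
    apply: (cvg0_le _ uy) => n; rewrite rip_ge0 /= lerDr g2//.
    exact: csubmodB.
  have xy := form_cvg_uniq rx ry; subst y; exists x => //.
  apply: (@cvg0_le _ _ (fun n => graph_form q1 (u n - x) (u n - x) +
    graph_form q2 (u n - x) (u n - x))).
    move=> n; have D1n := csubmodB d1 (Du1 n) Dx.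
    have D2n := csubmodB d2 (Du2 n) Dy.
    have := g1 _ D1n; have := g2 _ D2n; have := rip_ge0 (u n - x).
    by rewrite /graph_form => *; apply/andP; split; lra.
  by rewrite -[X in _ --> X](addr0 0); exact: cvgD.
Qed.

End RelationForms.
(** * Form sums and parallel sums *)

Section ParallelSum.
Variables (R : realType) (H : hilbertSpace R).
Local Notation rel := (set (H * H)).
Implicit Types (A B C X : rel) (D : set H) (q : H -> H -> R) (c : R).

Lemma lr_invK A : lr_inv (lr_inv A) = A.
Proof. by apply/seteqP; split=> -[]. Qed.

Lemma form_rel_dom A x y : nonneg_selfadjoint A -> A (x, y) ->
  form_dom A x /\ forall z, form_dom A z -> rel_form A z x = rip z y.
Proof. by move=> nA; rewrite -{1}(rel_formK nA). Qed.

Lemma form_sumE A B : nonneg_selfadjoint A -> nonneg_selfadjoint B ->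
  form_sum A B = form_rel (form_dom A `&` form_dom B)
    (fun x y => rel_form A x y + rel_form B x y).
Proof.
move=> nA nB; apply: lr_of_formE => [|x _].
  exact: closed_formD (rel_form_closed nA) (rel_form_closed nB).
by rewrite !lr_formE rmorphD.
Qed.

Lemma form_sum_form A B : nonneg_selfadjoint A -> nonneg_selfadjoint B ->
  [/\ nonneg_selfadjoint (form_sum A B),
      form_dom (form_sum A B) = form_dom A `&` form_dom B &
      forall x, form_dom A x -> form_dom B x ->
        rel_form (form_sum A B) x x = rel_form A x x + rel_form B x x].
Proof.
move=> nA nB; rewrite form_sumE//.
have c := closed_formD (rel_form_closed nA) (rel_form_closed nB).
have [d e] := form_relK c; split=> //; first exact: form_rel_nsa.
by move=> x Ax Bx; exact: e.
Qed.

Lemma form_sum_nsa A B : nonneg_selfadjoint A -> nonneg_selfadjoint B ->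
  nonneg_selfadjoint (form_sum A B).
Proof. by move=> nA nB; have [] := form_sum_form nA nB. Qed.

Lemma lr_of_form_ext D (Q Q' : H -> R[i]) :
  (forall x, D x -> Q x = Q' x) -> lr_of_form D Q = lr_of_form D Q'.
Proof.
move=> QQ; congr (xget _ _); apply/seteqP.
by split=> T [nT TD TQ]; split=> // x Dx; rewrite TQ// QQ.
Qed.

Lemma form_sumC A B : form_sum A B = form_sum B A.
Proof.
rewrite /form_sum setIC; congr lr_of_form; apply/funext => x.
exact: addrC.
Qed.

Lemma form_sum_form_sum3 A B C :
  nonneg_selfadjoint A -> nonneg_selfadjoint B ->
  form_sum (form_sum A B) C = form_sum3 A B C.
Proof.
move=> nA nB; have [_ d e] := form_sum_form nA nB.
rewrite {1}/form_sum d /form_sum3; apply: lr_of_form_ext => x [[Ax Bx] _].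
by rewrite !lr_formE e// rmorphD.
Qed.

(** With commutativity of the form sum, the rotation reduces the right bracketing to the left
    one. *)
Lemma form_sum3_rot A B C : form_sum3 A B C = form_sum3 B C A.
Proof.
rewrite /form_sum3 -setIA [form_dom A `&` _]setIC; congr lr_of_form.
by apply/funext => x; rewrite -addrA addrC.
Qed.

Lemma lr_leP A1 A2 : lr_le A1 A2 <->
  form_le (form_dom A1) (rel_form A1) (form_dom A2) (rel_form A2).
Proof.
split=> [[d l] x Dx|l].
  by split; [exact: d|have := l x Dx; rewrite !lr_formE lecR].
by split=> x Dx; have [h1 h2] := l x Dx; rewrite // !lr_formE lecR.
Qed.

Lemma lr_le_inv A1 A2 : nonneg_selfadjoint A1 -> nonneg_selfadjoint A2 ->
  lr_le A1 A2 -> lr_le (lr_inv A2) (lr_inv A1).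
Proof.
move=> n1 n2 /lr_leP le12; apply/lr_leP.
have [i1 i2] := (nsa_inv n1, nsa_inv n2).
apply: form_le_of_resolvent; [exact: rel_form_closed|exact: rel_form_closed|].
move=> f1 f2 h; rewrite !rel_formK// => r1 r2.
(* [h - f2] and [h - f1] are the values at [h] of the resolvents of [A1] and [A2]. *)
have := @form_le_resolvent _ _ _ _ _ _ (h - f2) (h - f1) h
  (rel_form_closed n1) (rel_form_closed n2) le12.
rewrite !rel_formK// !subKr => /(_ r2 r1).
by rewrite !ripBl; lra.
Qed.

Lemma psum_nsa A B : nonneg_selfadjoint A -> nonneg_selfadjoint B ->
  nonneg_selfadjoint (psum A B).
Proof. by move=> nA nB; apply: nsa_inv; apply: form_sum_nsa; exact: nsa_inv. Qed.

Lemma psum_le A B : nonneg_selfadjoint A -> nonneg_selfadjoint B ->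
  lr_le (psum A B) A.
Proof.
move=> nA nB; have [iA iB] := (nsa_inv nA, nsa_inv nB).
rewrite -[X in lr_le _ X]lr_invK; apply: lr_le_inv => //.
  exact: form_sum_nsa.
have [_ d e] := form_sum_form iA iB; apply/lr_leP => x.
rewrite d => -[Ax Bx]; split=> //; rewrite e// lerDl.
exact: rip_ge0.
Qed.

Lemma psum_mono A1 A2 B : nonneg_selfadjoint A1 -> nonneg_selfadjoint A2 ->
  nonneg_selfadjoint B -> lr_le A1 A2 -> lr_le (psum A1 B) (psum A2 B).
Proof.
move=> n1 n2 nB /(lr_le_inv n1 n2)/lr_leP le12.
have [i1 i2 iB] := And3 (nsa_inv n1) (nsa_inv n2) (nsa_inv nB).
apply: lr_le_inv; [exact: form_sum_nsa|exact: form_sum_nsa|].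
have [_ d1 e1] := form_sum_form i1 iB; have [_ d2 e2] := form_sum_form i2 iB.
apply/lr_leP => x; rewrite d1 d2 => -[A1x Bx]; have [A2x h] := le12 x A1x.
by split=> //; rewrite e1// e2// lerD2r.
Qed.

Lemma lr_scaleP c A x y : c != 0 ->
  lr_scale c A (x, y) <-> A (x, (c^-1)%:C *: y).
Proof.
move=> c0; split=> [[[a b] /= Aab [<- <-]]|Axy].
  by rewrite scalerA -rmorphM mulVf// scale1r.
by exists (x, (c^-1)%:C *: y) => //=; rewrite scalerA -rmorphM mulfV// scale1r.
Qed.

Lemma closed_formZ c D q : 0 < c -> closed_form D q ->
  closed_form D (fun x y => c * q x y).
Proof.
move=> c0 [s i k]; have [d sy l g] := s; split.
- split=> // [x y Dx Dy|t x y z Dx Dy Dz|x Dx].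
  + by rewrite sy.
  + by rewrite l//; ring.
  + by rewrite mulr_ge0 ?g// ltW.
- by move=> x y Dx Dy; rewrite i.
- move=> u Du uc.
  have [e e0|x Dx ux] := k u Du.
    (* The graph form of [q] is at most [1 + 1/c] times that of [c q]; conversely the latter is at
       most [c + 1] times the former. *)
    pose r := 1 + c^-1; have r0 : 0 < r by rewrite addr_gt0// invr_gt0.
    have [|N hN] := uc (e / r); first exact: divr_gt0.
    exists N => m n Nm Nn; have := hN m n Nm Nn; rewrite ler_pdivlMr//.
    apply: le_trans; rewrite /graph_form /r.
    have := g _ (csubmodB d (Du m) (Du n)); have := rip_ge0 (u m - u n).
    move: (q _ _) (rip _ _) => a b b0 a0.
    have -> : (c * a + b) * (1 + c^-1) = c * a + b + a + b / c.
      by field; rewrite gt_eqF.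
    have := mulr_ge0 (ltW c0) a0.
    have : 0 <= b / c by rewrite divr_ge0// ltW.
    lra.
  exists x => //.
  apply: (@cvg0_le _ _ (fun n => (c + 1) * graph_form q (u n - x) (u n - x))).
    move=> n; have := g _ (csubmodB d (Du n) Dx); have := rip_ge0 (u n - x).
    rewrite /graph_form; move: (q _ _) (rip _ _) => a b b0 a0.
    have := mulr_ge0 (ltW c0) a0; have := mulr_ge0 (ltW c0) b0.
    by move=> *; apply/andP; split; lra.
  by rewrite -[X in _ --> X](mulr0 (c + 1)); exact: cvgMr.
Qed.

Lemma form_relZ c D q : 0 < c ->
  form_rel D (fun x y => c * q x y) = lr_scale c (form_rel D q).
Proof.
move=> c0; have cn : c != 0 by rewrite gt_eqF.
apply/seteqP; split=> -[x y]; rewrite lr_scaleP// => -[/= Dx h].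
  by split=> //= f Df; rewrite ripZr -h// mulrA mulVf// mul1r.
by split=> //= f Df; rewrite h// ripZr mulrA mulfV// mul1r.
Qed.

Lemma lr_scale_form c A : 0 < c -> nonneg_selfadjoint A ->
  [/\ nonneg_selfadjoint (lr_scale c A), form_dom (lr_scale c A) = form_dom A &
    forall x y, form_dom A x -> form_dom A y ->
      rel_form (lr_scale c A) x y = c * rel_form A x y].
Proof.
move=> c0 nA; have cz := closed_formZ c0 (rel_form_closed nA).
have e : lr_scale c A = form_rel (form_dom A) (fun x y => c * rel_form A x y).
  by rewrite form_relZ// rel_formK.
by rewrite e; have [d1 d2] := form_relK cz; split=> //; exact: form_rel_nsa.
Qed.

Lemma form_sum_scale c A B : 0 < c ->
  nonneg_selfadjoint A -> nonneg_selfadjoint B ->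
  form_sum (lr_scale c A) (lr_scale c B) = lr_scale c (form_sum A B).
Proof.
move=> c0 nA nB; have [sA dA eA] := lr_scale_form c0 nA.
have [sB dB eB] := lr_scale_form c0 nB.
rewrite !form_sumE// -form_relZ// dA dB; apply: form_rel_ext => // x y.
by move=> [Ax Bx] [Ay By]; rewrite eA// eB// mulrDr.
Qed.

Lemma lr_inv_scale c A : c != 0 -> csubmod A ->
  lr_inv (lr_scale c A) = lr_scale c^-1 (lr_inv A).
Proof.
move=> c0 As; have ci0 : c^-1 != 0 by rewrite invr_eq0.
apply/seteqP; split=> -[x y].
  rewrite lr_scaleP// => /lr_scaleP-/(_ c0) h; rewrite /lr_inv /= invrK.
  have := csubmodZ c%:C As h.
  by rewrite -[_ *: (_, _)]/(_ *: _, _ *: _) scalerA -rmorphM mulfV// scale1r.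
rewrite lr_scaleP// /lr_inv /= invrK lr_scaleP// => h.
have := csubmodZ (c^-1)%:C As h.
by rewrite -[_ *: (_, _)]/(_ *: _, _ *: _) scalerA -rmorphM mulVf// scale1r.
Qed.

Lemma lr_scale_scale c d A : lr_scale c (lr_scale d A) = lr_scale (c * d) A.
Proof.
apply/seteqP; split=> p.
  by move=> [_ [r Ar <-] <-]; exists r => //=; rewrite scalerA -rmorphM.
move=> [r Ar <-]; exists (r.1, d%:C *: r.2); first by exists r.
by rewrite /= scalerA -rmorphM.
Qed.

Lemma lr_scale1 A : lr_scale 1 A = A.
Proof.
apply/seteqP; split=> p.
  by move=> [r Ar <-]; rewrite scale1r -surjective_pairing.
by move=> Ap; exists p => //; rewrite scale1r -surjective_pairing.
Qed.

Lemma psum_scale c A B : 0 < c -> nonneg_selfadjoint A -> nonneg_selfadjoint B ->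
  psum (lr_scale c A) (lr_scale c B) = lr_scale c (psum A B).
Proof.
move=> c0 nA nB; have cn : c != 0 by rewrite gt_eqF.
have [iA iB] := (nsa_inv nA, nsa_inv nB).
rewrite /psum (lr_inv_scale cn (nsa_csubmod nA)).
rewrite (lr_inv_scale cn (nsa_csubmod nB)) form_sum_scale ?invr_gt0//.
rewrite lr_inv_scale ?invr_eq0// ?invrK//.
exact: nsa_csubmod (form_sum_nsa iA iB).
Qed.

Lemma psum_assoc A B C :
  nonneg_selfadjoint A -> nonneg_selfadjoint B -> nonneg_selfadjoint C ->
  psum (psum A B) C = psum A (psum B C) /\
  psum A (psum B C) = lr_inv (form_sum3 (lr_inv A) (lr_inv B) (lr_inv C)).
Proof.
move=> nA nB nC; have [iA iB iC] := And3 (nsa_inv nA) (nsa_inv nB) (nsa_inv nC).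
have e : psum A (psum B C) = lr_inv (form_sum3 (lr_inv A) (lr_inv B) (lr_inv C)).
  rewrite /psum lr_invK form_sumC form_sum_form_sum3//.
  by congr lr_inv; rewrite [RHS]form_sum3_rot.
by split=> //; rewrite e /psum lr_invK form_sum_form_sum3.
Qed.

Lemma lr_ran_sqrt_psum A B : nonneg_selfadjoint A -> nonneg_selfadjoint B ->
  lr_ran (lr_sqrt (psum A B)) = lr_ran (lr_sqrt A) `&` lr_ran (lr_sqrt B).
Proof.
move=> nA nB; rewrite !lr_ran_sqrt//; last exact: psum_nsa.
have [_ d _] := form_sum_form (nsa_inv nA) (nsa_inv nB).
by rewrite /psum lr_invK d.
Qed.

(** The inverse of the zero relation is [{0} x H], the relation of the form with domain [{0}]. *)
Lemma nsa_eq0 X : nonneg_selfadjoint X ->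
  X = lr_zero H <-> lr_ran (lr_sqrt X) = [set 0].
Proof.
move=> nX; have iX := nsa_inv nX; rewrite lr_ran_sqrt//.
have cX := rel_form_closed iX; have [[D0 _] _ _ _] := closed_semidef cX.
split=> [X0|d0].
  apply/seteqP; split=> [x Dx|_ ->//].
  have : lr_inv X (0, x) by rewrite X0.
  move=> /(form_rel_dom iX)[_ /(_ _ Dx)] h; apply: rip_eq0; rewrite -h.
  have sX := closed_semidef cX.
  by rewrite (semidef_sym sX)//; exact: (semidef0l sX).
rewrite -[X]lr_invK -(rel_formK iX) d0; apply/seteqP.
split=> [p [/= p0 _]|p /= p0]; first exact: p0.
split; first exact: p0.
move=> f ->; rewrite p0 rip0l; have sX := closed_semidef cX.
exact: (semidef0l sX).
Qed.

(** The form sum of the inverses is twice [A^-1]; inversion turns the factor 2 into 1/2, which the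
    mean cancels. *)
Lemma hmean_restriction A B : nonneg_selfadjoint A -> nonneg_selfadjoint B ->
  form_dom (lr_inv A) `<=` form_dom (lr_inv B) ->
  (forall x, form_dom (lr_inv A) x ->
    lr_form (lr_inv A) x = lr_form (lr_inv B) x) ->
  hmean A B = A.
Proof.
move=> nA nB dAB eAB; have [iA iB] := (nsa_inv nA, nsa_inv nB).
have two : 0 < 2 :> R by [].
have e : form_sum (lr_inv A) (lr_inv B) = lr_scale 2 (lr_inv A).
  rewrite -{2}(rel_formK iA) -form_relZ// -(lr_of_formE (Q := fun x =>
    lr_form (lr_inv A) x + lr_form (lr_inv B) x)).
  - by rewrite /form_sum setIidl.
  - by apply: closed_formZ => //; exact: rel_form_closed.
  - by move=> x Dx; rewrite -eAB// lr_formE -rmorphD; congr (_%:C); ring.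
rewrite /hmean /psum e lr_inv_scale//; last exact: nsa_csubmod.
by rewrite lr_invK lr_scale_scale mulfV// lr_scale1.
Qed.

End ParallelSum.
(** * Strong resolvent limits *)

Section ResolventLimits.
Variables (R : realType) (H : hilbertSpace R).
Local Notation rel := (set (H * H)).
Implicit Types (A B X : rel) (c : R).

Lemma lr_shiftP c A x y : lr_shift A c (x, y) <-> A (x, y - c%:C *: x).
Proof.
split=> [[[a b] /= Aab [<- <-]]|Axy]; first by rewrite addrK.
by exists (x, y - c%:C *: x) => //=; rewrite subrK.
Qed.

Lemma nsa_resolvent_uniq A h f g : nonneg_selfadjoint A ->
  A (f, h - f) -> A (g, h - g) -> f = g.
Proof.
move=> nA Af Ag; apply/eqP; rewrite -subr_eq0; apply/eqP/rip_le0.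
have := nsa_ge0 nA (csubmodB (nsa_csubmod nA) Af Ag) => /=.
by rewrite !(ripBl, ripBr); lra.
Qed.

Lemma lr_app_resolvent X h g : nonneg_selfadjoint X -> X (g, h - g) ->
  lr_app (lr_inv (lr_shift X 1)) h = g.
Proof.
move=> nX Xg.
have sh x : lr_inv (lr_shift X 1) (h, x) <-> X (x, h - x).
  by rewrite /lr_inv /= lr_shiftP scale1r.
apply: xget_unique => [|x /sh Xx]; first exact/sh.
exact: nsa_resolvent_uniq nX Xx Xg.
Qed.

Lemma nsa_shift A c : 0 <= c -> nonneg_selfadjoint A ->
  nonneg_selfadjoint (lr_shift A c).
Proof.
move=> c0 nA; have [A0 AD] := nsa_csubmod nA.
apply/nonneg_selfadjointP; split.
- split=> [|t x y].
    by rewrite -[0]/(0, 0) lr_shiftP scaler0 subr0.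
  rewrite [x]surjective_pairing [y]surjective_pairing pair_lin !lr_shiftP.
  move=> Ax Ay; have := AD t _ _ Ax Ay; rewrite pair_lin /=.
  congr (A (_, _)); rewrite scalerBr scalerDr !scalerA [c%:C * t]mulrC.
  by rewrite opprD addrACA.
- apply/seteqP; split=> [[x y] hq|[x y] /lr_shiftP Axy [a b] /lr_shiftP Aab].
    apply/lr_shiftP; apply: nsa_adj => // -[a b] Aab /=.
    have /hq : lr_shift A c (a, b + c%:C *: a) by rewrite lr_shiftP addrK.
    by rewrite /= ripDl ripBr ripZl ripZr => <-; ring.
  have := nsa_sym nA Aab Axy => /=.
  by rewrite ripBl ripBr ripZl ripZr; lra.
- move=> [a b] /lr_shiftP Aab; have := nsa_ge0 nA Aab => /=.
  have := mulr_ge0 c0 (rip_ge0 a); rewrite ripBl ripZl; lra.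
Qed.

(** [A + c] is [c] times [A / c + 1], whose surjectivity is known. *)
Lemma lr_shift_surj A c h : 0 < c -> nonneg_selfadjoint A ->
  exists f, lr_inv (lr_shift A c) (h, f).
Proof.
move=> c0 nA; have ci : 0 < c^-1 by rewrite invr_gt0.
have cn : c != 0 by rewrite gt_eqF.
have [nS _ _] := lr_scale_form ci nA.
have [f] := nsa_resolvent ((c^-1)%:C *: h) nS.
rewrite lr_scaleP ?invr_eq0// invrK scalerBr scalerA -rmorphM mulfV// scale1r.
by exists f; rewrite /lr_inv /= lr_shiftP.
Qed.

(** The sum of relations lies in the form sum and is everywhere defined; symmetry of the form sum
    then fixes every second component. *)
Lemma form_sum_add A B : nonneg_selfadjoint A -> nonneg_selfadjoint B ->
  (forall x, exists y, A (x, y)) -> (forall x, exists y, B (x, y)) ->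
  form_sum A B = lr_add A B.
Proof.
move=> nA nB tA tB; have nF := form_sum_nsa nA nB.
have sub : lr_add A B `<=` form_sum A B.
  move=> [x z] [y [y' [/= Ay By' ->]]]; rewrite form_sumE//.
  have [dA eA] := form_rel_dom nA Ay; have [dB eB] := form_rel_dom nB By'.
  by split=> // f [Af Bf]; rewrite /= eA// eB// ripDr.
apply/seteqP; split=> // -[x z] Fz.
have [y Ay] := tA x; have [y' By] := tB x.
have Ad : lr_add A B (x, y + y') by exists y, y'.
suff -> : z = y + y' by [].
apply/rip_ext => h.
have [k Ak] := tA h; have [k' Bk] := tB h.
have Fk : form_sum A B (h, k + k') by apply: sub; exists k, k'.
have := nsa_sym nF Fz Fk; have := nsa_sym nF (sub _ Ad) Fk.
by rewrite /= ![rip h _]ripC => -> ->.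
Qed.

(** * Convergence of perturbed form sums *)

Section Perturbation.
Variables (A B : rel) (h : H) (phi fA fB : nat -> H) (eps : nat -> R).
Hypotheses (nA : nonneg_selfadjoint A) (nB : nonneg_selfadjoint B).
Hypotheses (eps_ge0 : forall n, 0 <= eps n)
  (eps_decr : forall n m, (n <= m)%N -> eps m <= eps n)
  (eps_cvg0 : eps @ \oo --> (0 : R)).
Hypothesis phiE : forall n, fA n + fB n + phi n = h.

(** Equivalently, [(f n, phi n)] lies in [X^-1 + eps n]. The relations of this section stand for the
    inverses of those in the parallel sum. *)
Definition perturbed X (f : nat -> H) :=
  forall n, X (phi n - (eps n)%:C *: f n, f n).

Hypotheses (AfA : perturbed A fA) (BfB : perturbed B fB).
Local Notation psi f n := (phi n - (eps n)%:C *: f n).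

Section Component.
Variables (X : rel) (f : nat -> H).
Hypotheses (nX : nonneg_selfadjoint X) (Xf : perturbed X f).

Lemma perturbed_form n : form_dom X (psi f n) /\
  forall x, form_dom X x -> rel_form X x (psi f n) = rip x (f n).
Proof. exact: (form_rel_dom nX (Xf n)). Qed.

(* [perturbed_form] evaluates the cross term [q (psi_n, psi_m)] as
   [(psi_m, f_n)], whose defect [eps_m (f_m, f_n)] is absorbed by the squares. *)
Lemma perturbed_diff n m : (n <= m)%N ->
  rel_form X (psi f n - psi f m) (psi f n - psi f m) <=
  rip (phi n) (f n) + rip (phi m) (f m) - 2 * rip (phi m) (f n).
Proof.
move=> nm; have sX := closed_semidef (rel_form_closed nX).
have [dn en] := perturbed_form n; have [dm em] := perturbed_form m.
rewrite (semidefB_sqr sX)// (semidef_sym sX dn dm) !en// em//.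
rewrite !(ripBl (phi _)) !ripZl.
have := mulr_ge0 (eps_ge0 m) (rip_ge0 (f n - f m)).
rewrite !(ripBl, ripBr) [rip (f n) (f m)]ripC.
have : 0 <= (eps n - eps m) * rip (f n) (f n).
  by rewrite mulr_ge0 ?rip_ge0// subr_ge0 eps_decr.
lra.
Qed.

Lemma perturbed_ge0 n :
  0 <= eps n * rip (f n) (f n) <= rip (phi n) (f n).
Proof.
rewrite mulr_ge0 ?rip_ge0//=.
have := nsa_ge0 nX (Xf n) => /=; rewrite ripBr ripZr [rip _ (phi n)]ripC; lra.
Qed.

End Component.

Local Notation d n := (rip (phi n) h).

Lemma energyE n m :
  rip (phi n) h = rip (phi n) (fA m) + rip (phi n) (fB m) + rip (phi n) (phi m).
Proof. by rewrite -(phiE m) !ripDr. Qed.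

(** On adding the three terms, [energyE] turns the diagonal ones into [d n + d m] and the mixed ones
    into [2 * d m]. *)
Lemma energy_diff n m : (n <= m)%N ->
  rel_form A (psi fA n - psi fA m) (psi fA n - psi fA m) +
  rel_form B (psi fB n - psi fB m) (psi fB n - psi fB m) +
  rip (phi n - phi m) (phi n - phi m) <= d n - d m.
Proof.
move=> nm; have := perturbed_diff nA AfA nm; have := perturbed_diff nB BfB nm.
have := energyE n n; have := energyE m m; have := energyE m n.
rewrite [rip (phi n - phi m) _]ripBl !ripBr [rip (phi n) (phi m)]ripC; lra.
Qed.

Lemma energy_diff_le n m : (n <= m)%N ->
  [/\ rel_form A (psi fA n - psi fA m) (psi fA n - psi fA m) <= d n - d m,
      rel_form B (psi fB n - psi fB m) (psi fB n - psi fB m) <= d n - d m,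
      rip (phi n - phi m) (phi n - phi m) <= d n - d m & d m <= d n].
Proof.
move=> nm; have := energy_diff nm; have := rip_ge0 (phi n - phi m).
have : 0 <= rel_form A (psi fA n - psi fA m) (psi fA n - psi fA m).
  exact: rip_ge0.
have : 0 <= rel_form B (psi fB n - psi fB m) (psi fB n - psi fB m).
  exact: rip_ge0.
by move=> *; split; lra.
Qed.

Lemma energy_bounds n : rip (phi n) (fA n) <= d n /\ rip (phi n) (fB n) <= d n.
Proof.
have := energyE n n; have := rip_ge0 (phi n).
have /andP[] := perturbed_ge0 nA AfA n; have /andP[] := perturbed_ge0 nB BfB n.
by move=> *; split; lra.
Qed.

Lemma energy_cauchy (e : R) : 0 < e -> exists N, forall n m,
  (N <= n)%N -> (n <= m)%N -> d n - d m <= e.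
Proof.
move=> e0; have d0 n : 0 <= d n.
  have [h1 _] := energy_bounds n; apply: le_trans h1.
  by have /andP[h1 h2] := perturbed_ge0 nA AfA n; exact: le_trans h1 h2.
have dn : nonincreasing_seq (fun n => d n).
  by move=> n m nm; have [] := energy_diff_le nm.
have dc : cvgn (fun n => d n).
  by apply: nonincreasing_is_cvgn => //; exists 0 => _ [n _ <-].
have /cvgrPdist_le/(_ _ e0)[N _ hN] := dc; exists N => n m Nn nm.
have /= := hN n Nn; have := nonincreasing_cvgn_ge dn dc m => hm.
rewrite distrC => /(le_trans (ler_norm _)); lra.
Qed.

Lemma phi_cauchy : form_cauchy rip phi.
Proof.
apply: (form_cauchy_le (rip_semidef (@csubmodT R H))) => // e.
move=> /energy_cauchy[N hN]; exists N => n m Nn nm.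
by have [_ _ h1 _] := energy_diff_le nm; exact: le_trans h1 (hN _ _ Nn nm).
Qed.

(** As [eps n * |f n|^2 <= d 0], the corrections [eps n * f n] tend to 0 and [psi f n] has the same
    norm limit as [phi n]. It is Cauchy in the graph form, so closedness puts [z] in the form
    domain. *)
Lemma perturbed_cvg X f z : nonneg_selfadjoint X -> perturbed X f ->
  (forall n, rip (phi n) (f n) <= d n) ->
  (forall n m, (n <= m)%N ->
    rel_form X (psi f n - psi f m) (psi f n - psi f m) <= d n - d m) ->
  form_cvg rip phi z ->
  form_dom X z /\ forall x, form_dom X x ->
    (fun n => rip x (f n)) @ \oo --> rel_form X x z.
Proof.
move=> nX Xf fd fdiff phiz.
have psiz : form_cvg rip (fun n => psi f n) z.
  apply: (@cvg0_le _ _ (fun n => 2 * rip (phi n - z) (phi n - z) +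
      2 * (d 0%N * eps n))).
    move=> n; rewrite rip_ge0 /= addrAC.
    apply: le_trans (ripD_sqr_le _ _) _; rewrite lerD2l ler_wpM2l//.
    rewrite ripNl ripNr opprK ripZl ripZr mulrC ler_wpM2r//.
    have /andP[_ h1] := perturbed_ge0 nX Xf n; apply: le_trans h1 _.
    by apply: le_trans (fd n) _; have [] := energy_diff_le (leq0n n).
  rewrite [X in _ --> X](_ : 0 = 2 * 0 + 2 * (d 0%N * 0)); last by ring.
  by apply: cvgD; apply: cvgMr => //; apply: cvgMr.
have [sX _ kX] := rel_form_closed nX.
have dpsi n : form_dom X (psi f n) by have [] := perturbed_form nX Xf n.
have [|x Dx xlim] := kX (fun n => psi f n) dpsi.
  apply: (form_cauchy_le (semidef_graph sX)) => // e e0.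
  have e4 : 0 < e / 8 by rewrite divr_gt0.
  have /cvgr0Pnorm_le/(_ _ e4)[N1 _ hN1] := psiz.
  have [N2 hN2] := energy_cauchy e4; exists (maxn N1 N2) => n m.
  rewrite geq_max => /andP[Nn1 Nn2] nm.
  have := hN2 n m Nn2 nm; have := fdiff n m nm.
  have := hN1 n Nn1; have := hN1 m (leq_trans Nn1 nm) => /=.
  rewrite !ger0_norm ?rip_ge0// /graph_form.
  have := ripD_sqr_le (psi f n - z) (- (psi f m - z)).
  rewrite (_ : psi f n - z - (psi f m - z) = psi f n - psi f m); last first.
    by apply: rip_ext => y; rewrite !(ripBr, ripDr); ring.
  rewrite [rip (- _) _]ripNl ripNr opprK; lra.
have dxn n : form_dom X (psi f n - x) by case: sX => ds _ _ _; exact: csubmodB.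
have zx : z = x.
  apply: (form_cvg_uniq psiz); apply: (cvg0_le _ xlim) => n.
  by rewrite rip_ge0 /= lerDr (semidef_ge0 sX).
subst x; split=> // y Dy.
rewrite (_ : (fun n => rip y (f n)) = fun n => rel_form X y (psi f n)).
  apply: (form_cvg_pair sX) => //; apply: (cvg0_le _ xlim) => n.
  by rewrite (semidef_ge0 sX)//= lerDl rip_ge0.
by apply/funext => n; have [_ ->] := perturbed_form nX Xf n.
Qed.

Lemma phi_cvg z : form_sum A B (z, h - z) -> form_cvg rip phi z.
Proof.
move=> Fz; have [y phiy] := rip_complete phi_cauchy.
have [||Ay limA] := perturbed_cvg nA AfA _ _ phiy.
- by move=> n; have [] := energy_bounds n.
- by move=> n m /energy_diff_le[].
have [||By limB] := perturbed_cvg nB BfB _ _ phiy.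
- by move=> n; have [] := energy_bounds n.
- by move=> n m /energy_diff_le[].
suff Fy : form_sum A B (y, h - y).
  by rewrite (nsa_resolvent_uniq (form_sum_nsa nA nB) Fz Fy).
rewrite form_sumE//; split=> // x [Ax Bx] /=.
have phix := form_cvg_pair (rip_semidef (@csubmodT R H)) (fun=> I) I (I : setT x) phiy.
(* [phiE] paired with [x] is constant in [n], and each of its three terms converges. *)
have lim : (fun _ : nat => rip x h) @ \oo -->
    rel_form A x y + rel_form B x y + rip x y.
  rewrite (_ : (fun=> _) =
      fun n => rip x (fA n) + rip x (fB n) + rip x (phi n)).
    by apply: cvgD => //; apply: cvgD; [exact: limA|exact: limB].
  by apply/funext => n; rewrite -(phiE n) !ripDr.
by rewrite ripBr (cvg_unique _ (cvg_cst (rip x h)) lim) ?addrK.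
Qed.

End Perturbation.

Lemma psum_resolvent_cvg A B :
  nonneg_selfadjoint A -> nonneg_selfadjoint B ->
  sR_lim (fun n => psum (lr_shift A n.+1%:R^-1) (lr_shift B n.+1%:R^-1))
         (psum A B) /\
  sR_lim (fun n => lr_inv (lr_add (lr_inv (lr_shift A n.+1%:R^-1))
                                  (lr_inv (lr_shift B n.+1%:R^-1))))
         (psum A B).
Proof.
move=> nA nB; pose e n : R := n.+1%:R^-1.
have e0 n : 0 < e n by rewrite invr_gt0.
have nAn n : nonneg_selfadjoint (lr_inv (lr_shift A (e n))).
  by apply: nsa_inv; apply: nsa_shift => //; exact: ltW.
have nBn n : nonneg_selfadjoint (lr_inv (lr_shift B (e n))).
  by apply: nsa_inv; apply: nsa_shift => //; exact: ltW.
(* Positive shifts are onto, so their inverses are everywhere defined; the two sequences of the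
   statement therefore coincide. *)
have addE n : form_sum (lr_inv (lr_shift A (e n))) (lr_inv (lr_shift B (e n))) =
    lr_add (lr_inv (lr_shift A (e n))) (lr_inv (lr_shift B (e n))).
  by apply: form_sum_add => // x; exact: lr_shift_surj.
suff lim : sR_lim (fun n => psum (lr_shift A (e n)) (lr_shift B (e n))) (psum A B).
  split=> // h; have := lim h.
  by under eq_fun do rewrite /psum addE.
move=> h; have nP := psum_nsa nA nB.
have nPn n : nonneg_selfadjoint (psum (lr_shift A (e n)) (lr_shift B (e n))).
  by apply: nsa_inv; apply: form_sum_nsa.
have /choice[g hg] n := nsa_resolvent h (nPn n).
have [g0 hg0] := nsa_resolvent h nP.
rewrite (lr_app_resolvent nP hg0).
under eq_fun do rewrite (lr_app_resolvent (nPn _) (hg _)).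
(* The sum of relations splits [g n] into two parts, which [A + e n] and [B + e n] both send to
   [h - g n]. *)
have /choice[fA hA] n : exists fA, lr_inv A (h - g n - (e n)%:C *: fA, fA) /\
    lr_inv B (h - g n - (e n)%:C *: (g n - fA), g n - fA).
  have := hg n; rewrite /psum addE => -[fA [fB [/= Af Bf gE]]].
  have fBE : g n - fA = fB by rewrite gE addrC addKr.
  by exists fA; rewrite fBE; move: Af Bf; rewrite /lr_inv /= !lr_shiftP.
pose phi n := h - g n.
have phi0 : form_cvg rip phi (h - g0).
  (* Here [h - g0] is the value at [h] of the resolvent of the form sum of the inverses. *)
  apply: (@phi_cvg _ _ h phi fA (fun n => g n - fA n) e (nsa_inv nA) (nsa_inv nB)).
  - by move=> n; exact: ltW.
  - by move=> n m nm; rewrite lef_pV2 ?posrE// ler_nat.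
  - exact: cvg_invn.
  - by move=> n; rewrite /phi [fA n + _]addrC subrK addrC subrK.
  - by move=> n; have [] := hA n.
  - by move=> n; have [] := hA n.
  - by move: hg0; rewrite /psum /lr_inv /= subKr.
have /form_cvgE hphi := phi0.
have -> : g = fun n => h - phi n by apply/funext => n; rewrite /phi subKr.
rewrite -[g0](subKr h).
by apply: cvgB => //; exact: cvg_cst.
Qed.

End ResolventLimits.

Local Close Scope complex_scope.

Theorem theorem4p2 (R : realType) (H : hilbertSpace R)
    (A B C A1 A2 : set (H * H)) :
  nonneg_selfadjoint A -> nonneg_selfadjoint B -> nonneg_selfadjoint C ->
  nonneg_selfadjoint A1 -> nonneg_selfadjoint A2 ->
  (* (1) *)
  (forall lambda : R, 0 < lambda ->
     psum (lr_scale lambda A) (lr_scale lambda B) = lr_scale lambda (psum A B)) /\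
  (* (2) *)
  psum A B = psum B A /\
  (* (3) *)
  (psum (psum A B) C = psum A (psum B C) /\
   psum A (psum B C) =
     lr_inv (form_sum3 (lr_inv A) (lr_inv B) (lr_inv C))) /\
  (* (4) *)
  (lr_le (psum A B) A /\ lr_le (psum A B) B) /\
  (* (5) *)
  (lr_le A1 A2 -> lr_le (psum A1 B) (psum A2 B)) /\
  (* (6) *)
  lr_ran (lr_sqrt (psum A B)) = lr_ran (lr_sqrt A) `&` lr_ran (lr_sqrt B) /\
  (* (7) *)
  (psum A B = lr_zero H <->
   lr_ran (lr_sqrt A) `&` lr_ran (lr_sqrt B) = [set 0]) /\
  (* (8) *)
  (form_dom (lr_inv A) `<=` form_dom (lr_inv B) ->
   (forall phi, form_dom (lr_inv A) phi ->
      lr_form (lr_inv A) phi = lr_form (lr_inv B) phi) ->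
   hmean A B = A) /\
  (* s-R-limits; the sequences start at n = 1 *)
  sR_lim (fun n => psum (lr_shift A n.+1%:R^-1) (lr_shift B n.+1%:R^-1))
         (psum A B) /\
  sR_lim (fun n => lr_inv (lr_add (lr_inv (lr_shift A n.+1%:R^-1))
                                  (lr_inv (lr_shift B n.+1%:R^-1))))
         (psum A B).
Proof.
move=> nA nB nC n1 n2; split; first by move=> l l0; exact: psum_scale.
split; first by rewrite /psum form_sumC.
split; first exact: psum_assoc.
split.
  split; first exact: psum_le.
  by rewrite /psum form_sumC; exact: psum_le.
split; first exact: psum_mono.
split; first exact: lr_ran_sqrt_psum.
split.
  by rewrite -lr_ran_sqrt_psum//; apply: nsa_eq0; exact: psum_nsa.
split; first exact: hmean_restriction.
exact: psum_resolvent_cvg.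
Qed.
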